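(* Let $0 < \varepsilon \leq 1/2$, let $k$ be any positive integer, and let $X \subseteq \mathbb{R}^d$ be a dataset of $n$ points. Then there is a query algorithm $A$ in the SSAC framework that runs in time $O(nd k^{9}/\varepsilon^4)$ and with probability at least $0.99$ outputs a center set $C$ with $\Phi(C, X) \leq (1 + \varepsilon) \cdot \Delta_k(X)$. Moreover, the number of same-cluster queries used by $A$ is $O(k^{9}/\varepsilon^4)$.
   Context: For a finite set $X\subseteq\mathbb{R}^d$ and a nonempty finite set $C\subseteq \mathbb{R}^d$, $\Phi(C,X)=\sum_{x\in X}\min_{c\in C}\|x-c\|^2$. The $k$-means problem asks for a set $C$ of $k$ points minimizing $\Phi(C,X)$; $\Delta_k(X)$ denotes the optimal value. An optimal solution induces optimal clusters $X_1,\dots,X_k$ (Voronoi partition of $X$ w.r.t. optimal centers). In the SSAC (Semi-Supervised Active Clustering) framework, one optimal clustering $X_1,\dots,X_k$ is fixed, and a (possibly randomized) algorithm may, in addition to its computation, make same-cluster queries: given two points $x\neq y$ of $X$, the oracle answers whether $x$ and $y$ belong to the same cluster $X_i$ of this fixed optimal clustering. *)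

(* Defs.v *)
From HB Require Import structures.
From mathcomp Require Import all_boot all_order all_algebra finmap.
From mathcomp Require Import all_classical all_reals.

Set Implicit Arguments.
Unset Strict Implicit.
Unset Printing Implicit Defensive.

Import Order.TTheory GRing.Theory Num.Theory.

Local Open Scope classical_set_scope.
Local Open Scope ring_scope.

(** * The k-means problem *)

(* The library norm on 'rV[R]_d is the sup norm, hence this definition. *)
Definition sqdist (R : realType) (d : nat) (x c : 'rV[R]_d) : R :=
  \sum_(j < d) (x 0 j - c 0 j) ^+ 2.

(* For nonempty C the initial value of the iterated minimum is the distance to
   an element of C, so this is min_{c in C} ||x - c||^2. *)
Definition min_sqdist (R : realType) (d : nat) (C : {fset 'rV[R]_d})
    (x : 'rV[R]_d) : R :=
  \big[Num.min/sqdist x (head 0 (enum_fset C))]_(c <- enum_fset C) sqdist x c.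

Definition Phi (R : realType) (d : nat) (C X : {fset 'rV[R]_d}) : R :=
  \sum_(x <- enum_fset X) min_sqdist C x.

Definition Delta (R : realType) (d k : nat) (X : {fset 'rV[R]_d}) : R :=
  inf [set Phi C X | C in [set C : {fset 'rV[R]_d} | #|` C| = k]].

Definition optimal_centers (R : realType) (d k : nat)
    (C X : {fset 'rV[R]_d}) : Prop :=
  #|` C| = k /\ Phi C X = Delta k X.

(* The clusters of a Voronoi partition of the points x_i with respect to C are
   the fibres of a; ties between nearest centers are broken arbitrarily. *)
Definition voronoi (R : realType) (d n : nat) (C : {fset 'rV[R]_d})
    (x a : 'I_n -> 'rV[R]_d) : Prop :=
  forall i, a i \in C /\ forall c, c \in C -> sqdist (x i) (a i) <= sqdist (x i) c.

(** * Randomized real RAM with same-cluster queries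

    A program is a closed finite piece of syntax: it contains no real constants
    and does not depend on the input. The memory consists of arrays of naturals
    and arrays of reals, indexed by naturals. Array names are constants of the
    program text; indices are computed. Naturals support only addition and
    truncated subtraction, and there is no conversion from reals to naturals. *)

Inductive iexpr : Type :=
| IConst of nat
| IGet of nat & iexpr
| IAdd of iexpr & iexpr
| ISub of iexpr & iexpr.

Inductive rexpr : Type :=
| RNat of iexpr
| RGet of nat & iexpr
| RAdd of rexpr & rexpr
| RSub of rexpr & rexpr
| RMul of rexpr & rexpr
| RDiv of rexpr & rexpr.

Inductive bexpr : Type :=
| ILe of iexpr & iexpr
| RLe of rexpr & rexpr
| BNot of bexpr
| BAnd of bexpr & bexpr.

(* [ISet b i e] and [RSet b i e] store the value of e in cell i of array b.
   [Flip b i p] stores in cell i of natural array b the result, 1 or 0, of a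
   coin with P(1) = p. [Query b i u v] stores there the oracle's answer, 1 or 0,
   to "are points number u and v in the same cluster?". *)
Inductive cmd : Type :=
| Skip
| ISet of nat & iexpr & iexpr
| RSet of nat & iexpr & rexpr
| Seq of cmd & cmd
| If of bexpr & cmd & cmd
| While of bexpr & cmd
| Flip of nat & iexpr & rexpr
| Query of nat & iexpr & iexpr & iexpr.

Record state (R : realType) : Type := State {
  imem : nat -> nat -> nat;
  rmem : nat -> nat -> R;
  nqueries : nat }.

Definition upd (T : Type) (m : nat -> nat -> T) (b i : nat) (v : T) :
    nat -> nat -> T :=
  fun b' i' => if (b' == b) && (i' == i) then v else m b' i'.

Definition iput (R : realType) (s : state R) (b i v : nat) : state R :=
  State (upd (imem s) b i v) (rmem s) (nqueries s).

Definition rput (R : realType) (s : state R) (b i : nat) (v : R) : state R :=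
  State (imem s) (upd (rmem s) b i v) (nqueries s).

Definition count_query (R : realType) (s : state R) : state R :=
  State (imem s) (rmem s) (nqueries s).+1.

Fixpoint ieval (R : realType) (s : state R) (e : iexpr) : nat :=
  match e with
  | IConst m => m
  | IGet b i => imem s b (ieval s i)
  | IAdd e1 e2 => (ieval s e1 + ieval s e2)%N
  | ISub e1 e2 => (ieval s e1 - ieval s e2)%N
  end.

Fixpoint reval (R : realType) (s : state R) (e : rexpr) : R :=
  match e with
  | RNat i => (ieval s i)%:R
  | RGet b i => rmem s b (ieval s i)
  | RAdd e1 e2 => reval s e1 + reval s e2
  | RSub e1 e2 => reval s e1 - reval s e2
  | RMul e1 e2 => reval s e1 * reval s e2
  | RDiv e1 e2 => reval s e1 / reval s e2
  end.

Fixpoint beval (R : realType) (s : state R) (e : bexpr) : bool :=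
  match e with
  | ILe e1 e2 => (ieval s e1 <= ieval s e2)%N
  | RLe e1 e2 => reval s e1 <= reval s e2
  | BNot e1 => ~~ beval s e1
  | BAnd e1 e2 => beval s e1 && beval s e2
  end.

(* A configuration is the stack of commands still to be executed, together with
   the memory; the machine has halted when the stack is empty. *)
Record config (R : realType) : Type := Config {
  todo : seq cmd;
  memory : state R }.

Definition halted (R : realType) (g : config R) : bool := nilp (todo g).

Variant transition (R : realType) : Type :=
| Move of config R
| Toss of R & config R & config R.

Definition clip (R : realType) (p : R) : R := Num.min 1 (Num.max 0 p).

Definition step (R : realType) (oracle : nat -> nat -> bool) (g : config R) :
    transition R :=
  let s := memory g in
  match todo g with
  | [::] => Move g
  | Skip :: K => Move (Config K s)
  | ISet b i e :: K => Move (Config K (iput s b (ieval s i) (ieval s e)))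
  | RSet b i e :: K => Move (Config K (rput s b (ieval s i) (reval s e)))
  | Seq c1 c2 :: K => Move (Config [:: c1, c2 & K] s)
  | If e c1 c2 :: K => Move (Config ((if beval s e then c1 else c2) :: K) s)
  | While e c :: K =>
      Move (Config (if beval s e then [:: c, While e c & K] else K) s)
  | Flip b i p :: K =>
      Toss (clip (reval s p)) (Config K (iput s b (ieval s i) 1))
                              (Config K (iput s b (ieval s i) 0))
  | Query b i u v :: K =>
      Move (Config K (iput (count_query s) b (ieval s i)
                           (oracle (ieval s u) (ieval s v))))
  end.

(* Probability that the configuration reached from g after t steps satisfies E,
   all coins being tossed independently. Running time is the number of steps:
   each step performs a number of machine operations that is bounded in terms of
   the program text only, and a halted machine stays as it is. *)
Fixpoint prob (R : realType) (oracle : nat -> nat -> bool) (t : nat)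
    (E : config R -> bool) (g : config R) : R :=
  if t is t'.+1 then
    match step oracle g with
    | Move g' => prob oracle t' E g'
    | Toss p g1 g0 =>
        p * prob oracle t' E g1 + (1 - p) * prob oracle t' E g0
    end
  else (E g)%:R.

(** * Input, oracle and output conventions *)

Definition dataset (R : realType) (d n : nat) (x : 'I_n -> 'rV[R]_d) :
    {fset 'rV[R]_d} := [fset x i | i in 'I_n]%fset.

(* Coordinate j of point i is at index i * d + j. *)
Definition row_major (R : realType) (d n : nat) (x : 'I_n -> 'rV[R]_d)
    (m : nat) : R :=
  match insub (m %/ d)%N : option 'I_n, insub (m %% d)%N : option 'I_d with
  | Some i, Some j => x i 0 j
  | _, _ => 0
  end.

(* Natural arrays 0, 1, 2 hold n, d, k in cell 0; real array 0 holds the points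
   and real array 1 holds eps in cell 0; all other cells are zero. *)
Definition input (R : realType) (d n k : nat) (eps : R)
    (x : 'I_n -> 'rV[R]_d) : state R :=
  State
    (fun b i => if i == 0%N then nth 0%N [:: n; d; k] b else 0%N)
    (fun b i => if b == 0%N then row_major x i
                else if (b == 1%N) && (i == 0%N) then eps else 0)
    0.

Definition init (R : realType) (d n k : nat) (A : cmd) (eps : R)
    (x : 'I_n -> 'rV[R]_d) : config R :=
  Config [:: A] (input k eps x).

(* Indices that do not denote points are answered negatively. *)
Definition same_cluster (R : realType) (d n : nat) (a : 'I_n -> 'rV[R]_d)
    (u v : nat) : bool :=
  match insub u : option 'I_n, insub v : option 'I_n with
  | Some i, Some j => a i == a j
  | _, _ => false
  end.

(* The k centers are read from real array 2, in row-major order. *)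
Definition center (R : realType) (d k : nat) (g : config R) (l : 'I_k) :
    'rV[R]_d := \row_(j < d) rmem (memory g) 2 (l * d + j)%N.

Definition output (R : realType) (d k : nat) (g : config R) :
    {fset 'rV[R]_d} := [fset center d g l | l in 'I_k]%fset.

(* Main.v *)
(** The algorithm first runs adaptive D^2-sampling for 1000 k rounds, without any
    query. By the lemma of Arthur and Vassilvitskii, as long as the cost of the
    seeds exceeds 32 times the optimum, each round turns an uncovered optimal
    cluster into a covered one with probability at least 1/4; hence the seeds
    end up within a factor 32 of the optimum.

    It then draws independent points with weight D^2 / (total cost) + 1 / (size
    of the Voronoi cell of the nearest seed), sorts them into the optimal
    clusters with at most k queries per point, and outputs the means weighted by
    the inverse sampling weights. If every point of a cluster has sampling
    probability at least 1 / (kappa * size of the cluster), Chebyshev's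
    inequality shows that its mean is estimated well. Otherwise some point of
    the cluster lies in a cell that is much larger than the cluster and mostly
    belongs to a few big clusters; as an optimal clustering is a Voronoi
    partition, the center of one of these is then so close that it can serve the
    whole small cluster. *)

Require Import Defs.
From HB Require Import structures.
From mathcomp Require Import all_boot all_order all_algebra finmap.
From mathcomp Require Import all_classical all_reals.
From mathcomp Require Import zify ring lra.

Import Order.TTheory GRing.Theory Num.Theory.

Local Open Scope ring_scope.

(** * A program logic with expected values and running times *)

(** Events are handled only through expectations. The program refines a composition of finite
    weighted averages, and any real function below the indicator of success may be averaged. The one
    used is [(1 - seed_fail) * (1 - Z)], where [Z] is a normalised sum of squared deviations, so
    Markov and union bounds become linearity of expectation. Origin of the sample size: the total
    sampling weight is O(k), and a badly sampled cluster may lose only about eps / k of the optimum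
    when it is served by another center. This forces kappa of order k^3 / eps. The second moment of
    the relative error is of order k * kappa / (N * eps), so N of order k^4 / eps^2 samples suffice.
    With k queries per sample this gives k^5 / eps^2 queries, well within the claim. The neighbour
    that serves a badly sampled cluster may be badly sampled itself. Sizes grow fourfold along such
    a chain, so it ends and the displacements sum like a geometric series. *)

Section Logic.
Set Implicit Arguments.
Unset Strict Implicit.
Variables (R : realType) (orc : nat -> nat -> bool).
Implicit Types (s : state R) (c : cmd).

Lemma clip01 (p : R) : 0 <= clip p <= 1.
Proof. by rewrite /clip le_min ge_min ler01 le_max !lexx. Qed.

Lemma prob01 t (E : config R -> bool) g : 0 <= prob orc t E g <= 1.
Proof.
elim: t g => [|t IH] g /=; first by case: (E g); rewrite ?lexx ?ler01.
case def_g: (step orc g) => [g'|p g1 g0]; first exact: IH.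
have : 0 <= p <= 1.
  case: g def_g => -[|[] // b i e K] s //= [<- _ _]; exact: clip01.
by have := IH g1; have := IH g0; nra.
Qed.

Lemma prob_mono t (E E' : config R -> bool) g :
  (forall g', E g' -> E' g') -> prob orc t E g <= prob orc t E' g.
Proof.
move=> EE; elim: t g => [|t IH] g /=.
  by rewrite ler_nat; case Eg: (E g) => //; rewrite (EE _ Eg).
case def_g: (step orc g) => [g'|p g1 g0]; first exact: IH.
have : 0 <= p <= 1.
  case: g def_g => -[|[] // b i e K] s //= [<- _ _]; exact: clip01.
by case/andP=> p0 p1; rewrite lerD // ler_wpM2l // subr_ge0.
Qed.

(* Within T steps, c started in s reaches a state related by Q to an outcome a,
   and expectations over the outcomes are bounded below by m; the continuation K
   and the event E make this compositional although branches take different times. *)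
Definition refines (T : nat) c s (A : Type) (Q : A -> state R -> Prop)
    (m : (A -> R) -> R) : Prop :=
  forall K E T' (f : A -> R),
    (forall a s' t, Q a s' -> (T' <= t)%N -> f a <= prob orc t E (Config K s')) ->
  forall t, (T + T' <= t)%N -> m f <= prob orc t E (Config (c :: K) s).

Definition ret (A : Type) (a : A) (f : A -> R) : R := f a.

Lemma refines_weaken T T' c s A (Q Q' : A -> state R -> Prop) m :
  refines T c s Q m -> (T <= T')%N -> (forall a s', Q a s' -> Q' a s') ->
  refines T' c s Q' m.
Proof.
move=> H le_T HQ K E T0 f Hf t Ht; apply: (H K E T0 f); last by lia.
by move=> a s' t' /HQ; apply: Hf.
Qed.

Lemma refines_mono T c s A (Q : A -> state R -> Prop) (m m' : (A -> R) -> R) :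
  refines T c s Q m' -> (forall f, m f <= m' f) -> refines T c s Q m.
Proof. by move=> H Hm K E T' f Hf t Ht; apply: le_trans (Hm f) (H _ _ _ _ Hf _ Ht). Qed.

Lemma refines_ret T c s A B (a : A) (b : B) (P : state R -> Prop)
    (Q : B -> state R -> Prop) :
  refines T c s (fun=> P) (ret a) -> (forall s', P s' -> Q b s') ->
  refines T c s Q (ret b).
Proof.
move=> H HQ K E T' f Hf; apply: (H K E T' (fun=> f b)) => _ s' t /HQ.
exact: Hf.
Qed.

Lemma refines_seq T1 T2 c1 c2 s A B (Q1 : A -> state R -> Prop)
    (Q2 : B -> state R -> Prop) m1 (m2 : A -> (B -> R) -> R) :
  refines T1 c1 s Q1 m1 -> (forall a s1, Q1 a s1 -> refines T2 c2 s1 Q2 (m2 a)) ->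
  refines (T1 + T2).+1 (Seq c1 c2) s Q2 (fun f => m1 (fun a => m2 a f)).
Proof.
move=> H1 H2 K E T' f Hf [|t] Ht; first by lia.
apply: (H1 (c2 :: K) E (T2 + T')%N); last by lia.
by move=> a s' t' /H2; apply.
Qed.

Lemma refines_if T e c1 c2 s A (Q : A -> state R -> Prop) m :
  refines T (if beval s e then c1 else c2) s Q m -> refines T.+1 (If e c1 c2) s Q m.
Proof.
move=> H K E T' f Hf [|t] Ht; first by lia.
by rewrite /=; apply: (H K E T' f Hf); lia.
Qed.

Lemma refines_flip b i p s :
  refines 1 (Flip b i p) s (fun v s' => s' = iput s b (ieval s i) (v : bool))
    (fun f => clip (reval s p) * f true + (1 - clip (reval s p)) * f false).
Proof.
move=> K E T' f Hf [|t] Ht; first by lia.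
rewrite /=; have /andP[p0 p1] := clip01 (reval s p).
by apply: lerD; apply: ler_wpM2l; rewrite ?subr_ge0 //; apply: Hf => //; lia.
Qed.

Fixpoint straight c : bool :=
  match c with
  | Seq c1 c2 => straight c1 && straight c2
  | If _ c1 c2 => straight c1 && straight c2
  | While _ _ | Flip _ _ _ => false
  | _ => true
  end.

Fixpoint cost c : nat :=
  match c with
  | Seq c1 c2 | If _ c1 c2 => (cost c1 + cost c2).+1
  | _ => 1
  end.

Fixpoint run c s : state R :=
  match c with
  | ISet b i e => iput s b (ieval s i) (ieval s e)
  | RSet b i e => rput s b (ieval s i) (reval s e)
  | Seq c1 c2 => run c2 (run c1 s)
  | If e c1 c2 => if beval s e then run c1 s else run c2 s
  | Query b i u v => iput (count_query s) b (ieval s i) (orc (ieval s u) (ieval s v))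
  | _ => s
  end.

Lemma refines_run c s : straight c ->
  refines (cost c) c s (fun _ s' => s' = run c s) (ret tt).
Proof.
elim: c s => // [|b i e|b i e|c1 IH1 c2 IH2|e c1 IH1 c2 IH2|b i u v] s;
  try by move=> _ K E T' f Hf [|t] /= Ht; [lia|apply: (Hf tt) => //; lia].
- move=> /= /andP[st1 st2].
  by apply: (refines_seq (m2 := fun=> ret tt) (IH1 s st1)) => _ _ ->; apply: IH2.
- move=> /= /andP[st1 st2]; apply: refines_if; case: ifP => _.
    by apply: refines_weaken (IH1 s st1) _ _ => //; lia.
  by apply: refines_weaken (IH2 s st2) _ _ => //; lia.
Qed.

Lemma refines_seq_run T T2 c1 c2 s B (Q : B -> state R -> Prop) m :
  straight c1 -> refines T2 c2 (run c1 s) Q m -> (cost c1 + T2 < T)%N ->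
  refines T (Seq c1 c2) s Q m.
Proof.
move=> st1 H2 lt_T; apply: (refines_weaken (T := (cost c1 + T2).+1) (Q := Q)) => //.
move=> K E T' f Hf t Ht.
have H : forall (a : unit) s1, s1 = run c1 s -> refines T2 c2 s1 Q m by move=> _ _ ->.
exact: (refines_seq (@refines_run c1 s st1) H Hf Ht).
Qed.

Lemma refines_seq_le T T1 T2 c1 c2 s A B (Q1 : A -> state R -> Prop)
    (Q2 : B -> state R -> Prop) m m1 (m2 : A -> (B -> R) -> R) :
  refines T1 c1 s Q1 m1 -> (forall a s1, Q1 a s1 -> refines T2 c2 s1 Q2 (m2 a)) ->
  (T1 + T2 < T)%N -> (forall f, m f <= m1 (fun a => m2 a f)) ->
  refines T (Seq c1 c2) s Q2 m.
Proof.
move=> H1 H2 lt_T Hm K E T' f Hf t Ht; apply: le_trans (Hm f) _.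
by apply: (refines_seq H1 H2 Hf); lia.
Qed.

Lemma refines_run_post T c s A (a : A) (Q : A -> state R -> Prop) :
  straight c -> Q a (run c s) -> (cost c <= T)%N -> refines T c s Q (ret a).
Proof.
move=> st HQ le_T; apply: (refines_ret (P := fun s' => s' = run c s)) => [|_ -> //].
exact: refines_weaken (@refines_run c s st) le_T _.
Qed.

(** Expected value of [f] after [r] steps of a Markov chain started in [a] at time [i], the chain
    being given by its one-step expectation operators. *)
Fixpoint miter (A : Type) (stp : nat -> A -> (A -> R) -> R) (i r : nat) (a : A)
    (f : A -> R) : R :=
  if r is r'.+1 then stp i a (fun a' => miter stp i.+1 r' a' f) else f a.

Lemma refines_while T g c s A (Inv : nat -> A -> state R -> Prop) N stp a :
  Inv 0%N a s ->
  (forall i a s, (i <= N)%N -> Inv i a s -> beval s g = (i < N)%N) ->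
  (forall i a s, (i < N)%N -> Inv i a s -> refines T c s (Inv i.+1) (stp i a)) ->
  refines (N * T.+1).+1 (While g c) s (Inv N) (miter stp 0 N a).
Proof.
move=> H0 Hg Hc.
suff: forall r i a s, (i + r = N)%N -> Inv i a s ->
    refines (r * T.+1).+1 (While g c) s (Inv N) (miter stp i r a) by apply.
elim=> [|r IH] i {H0 a s} a s Hi HI K E T' f Hf [|t] Ht; try lia.
  rewrite /= (Hg i a) //; last by lia.
  have -> : (i < N)%N = false by lia.
  by apply: Hf; [have <- : i = N by lia|lia].
rewrite /= (Hg i a) //; last by lia.
have -> : (i < N)%N by lia.
apply: (Hc i a s _ HI (While g c :: K) E ((r * T.+1).+1 + T')%N); try lia.
move=> a' s' t' HI' Ht'; apply: (IH i.+1 a' s' _ HI' K E T' f Hf) => //; lia.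
Qed.

Definition iget0 (b : nat) := IGet b (IConst 0).

Definition incr (b : nat) := ISet b (IConst 0) (IAdd (iget0 b) (IConst 1)).

Definition loop (b : nat) (g : bexpr) (c : cmd) :=
  Seq (ISet b (IConst 0) (IConst 0)) (While g (Seq c (incr b))).

Definition below (b : nat) (e : iexpr) := ILe (IAdd (iget0 b) (IConst 1)) e.

Lemma refines_loop T b g c s A (J : nat -> A -> state R -> Prop) N stp a :
  J 0%N a (iput s b 0 0) ->
  (forall i a s, (i <= N)%N -> imem s b 0 = i -> J i a s ->
     beval s g = (i < N)%N) ->
  (forall i a s, (i < N)%N -> imem s b 0 = i -> J i a s ->
     refines T c s (fun a' s' => imem s' b 0 = i /\ J i.+1 a' (iput s' b 0 i.+1))
       (stp i a)) ->
  refines (N * (T + 3) + 4) (loop b g c) s (J N) (miter stp 0 N a).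
Proof.
move=> H0 Hg Hc.
apply: (refines_weaken (T := (N * (T + 3) + 4)%N)
  (Q := fun a' s' => imem s' b 0 = N /\ J N a' s')); [|by []|by move=> ? ? []].
apply: (refines_seq_run (T2 := (N * (T + 2).+1).+1)) => //=; last by lia.
apply: (refines_while (Inv := fun i a s => imem s b 0 = i /\ J i a s)).
- by split; first by rewrite /= /upd !eqxx.
- by move=> i a' s' le_i [] ? ?; apply: (Hg i a').
- move=> i a' s' lt_i [bi HJ].
  apply: (refines_seq_le (T2 := 1) (m2 := fun a' => ret a') (Hc _ _ _ lt_i bi HJ)).
  + move=> a1 s1 [b1 HJ1]; apply: refines_run_post => //=.
    by rewrite /upd !eqxx b1 addn1.
  + by lia.
  + by [].
Qed.

Lemma miter_ret i r f : miter (fun _ _ => ret tt) i r tt f = f tt.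
Proof. by elim: r i => //= r IH i; rewrite /ret IH. Qed.

Lemma refines_det_loop T b g c s (J : nat -> state R -> Prop) N :
  J 0%N (iput s b 0 0) ->
  (forall i s, (i <= N)%N -> imem s b 0 = i -> J i s -> beval s g = (i < N)%N) ->
  (forall i s, (i < N)%N -> imem s b 0 = i -> J i s ->
     refines T c s (fun _ s' => imem s' b 0 = i /\ J i.+1 (iput s' b 0 i.+1))
       (ret tt)) ->
  refines (N * (T + 3) + 4) (loop b g c) s (fun _ => J N) (ret tt).
Proof.
move=> H0 Hg Hc.
have := @refines_loop T b g c s unit (fun i _ => J i) N (fun _ _ => ret tt) tt H0.
move=> /(_ (fun i _ => Hg i) (fun i _ => Hc i)) H K E T' f Hf t Ht.
by have := H K E T' f Hf t Ht; rewrite miter_ret.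
Qed.

(** Footprints consist of whole arrays, so that side conditions on them are settled by
    computation. *)
Definition frame (li lr : seq nat) s s' : Prop :=
  [/\ forall b i, b \notin li -> imem s' b i = imem s b i,
      forall b i, b \notin lr -> rmem s' b i = rmem s b i
    & nqueries s' = nqueries s].

Lemma frame_trans li lr s1 s2 s3 :
  frame li lr s1 s2 -> frame li lr s2 s3 -> frame li lr s1 s3.
Proof.
move=> [a1 b1 c1] [a2 b2 c2]; split=> [b i Hb|b i Hb|]; last by rewrite c2.
  by rewrite a2 // a1.
by rewrite b2 // b1.
Qed.

Lemma frame_sub li lr li' lr' s s' :
  all (mem li') li -> all (mem lr') lr ->
  frame li lr s s' -> frame li' lr' s s'.
Proof.
move=> /allP Hi /allP Hr [a b c]; split=> // [x i|x i] Hx.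
  by apply: a; apply: contra Hx => /Hi.
by apply: b; apply: contra Hx => /Hr.
Qed.

Lemma frame_iput li lr s s' b i v :
  b \in li -> frame li lr s s' -> frame li lr s (iput s' b i v).
Proof.
move=> Hb [a1 b1 c1]; split=> // b' i' Hb' /=; rewrite /upd.
case: eqP => [E|_] /=; last exact: a1.
by rewrite E Hb in Hb'.
Qed.

Lemma frame_rput li lr s s' b i v :
  b \in lr -> frame li lr s s' -> frame li lr s (rput s' b i v).
Proof.
move=> Hb [a1 b1 c1]; split=> // b' i' Hb' /=; rewrite /upd.
case: eqP => [E|_] /=; last exact: b1.
by rewrite E Hb in Hb'.
Qed.

End Logic.

Local Ltac frame_tac := do ![apply: frame_iput => //|apply: frame_rput => //].

(** * The program *)

Section Program.
Set Implicit Arguments.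
Unset Strict Implicit.

(* Natural arrays: 3, 4, 7, 12, 14 loop counters (7 also numbers the seeds); 5 the
   last sampled point; 6 coin; 8 cell of each point; 9 cell sizes; 10 and 11 the
   cluster representatives and their number; 13 oracle answer; 15 the multiples
   of d, as the machine cannot multiply naturals; 16 label of the last sample.
   Real arrays: 3 squared distances to the seeds; 4 accumulator; 5 weights;
   6 and 8 weighted counts and coordinate sums of each label; 7 cost of the seeds. *)
Definition rget0 (b : nat) := RGet b (IConst 0).

Fixpoint rpow (e : rexpr) (m : nat) : rexpr :=
  if m is m'.+1 then RMul e (rpow e m') else RNat (IConst 1).

Definition offsets : cmd :=
  loop 3 (below 3 (IAdd (iget0 0) (iget0 2)))
    (ISet 15 (IAdd (iget0 3) (IConst 1)) (IAdd (IGet 15 (iget0 3)) (iget0 1))).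

(** Weighted reservoir sampling: the current index replaces the held one with probability weight
    over running total. One pass suffices and the weights need no normalisation. *)
Definition sample (wa : nat) : cmd :=
  Seq (Seq (RSet 4 (IConst 0) (RNat (IConst 0))) (ISet 5 (IConst 0) (IConst 0)))
  (loop 3 (below 3 (iget0 0))
    (Seq (RSet 4 (IConst 0) (RAdd (rget0 4) (RGet wa (iget0 3))))
    (Seq (Flip 6 (IConst 0) (RDiv (RGet wa (iget0 3)) (rget0 4)))
         (If (ILe (IConst 1) (iget0 6)) (ISet 5 (IConst 0) (iget0 3)) Skip)))).

Definition pcoord (e : iexpr) : rexpr := RGet 0 (IAdd (IGet 15 e) (iget0 4)).

(** The test on array 7 lets the first seed overwrite the initial zeros, which are not distances.
    Ties go to the newer seed. *)
Definition add_seed : cmd :=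
  let df := RSub (pcoord (iget0 3)) (pcoord (iget0 5)) in
  loop 3 (below 3 (iget0 0))
    (Seq (RSet 4 (IConst 0) (RNat (IConst 0)))
    (Seq (loop 4 (below 4 (iget0 1))
           (RSet 4 (IConst 0) (RAdd (rget0 4) (RMul df df))))
         (If (BAnd (ILe (IConst 1) (iget0 7)) (BNot (RLe (rget0 4) (RGet 3 (iget0 3)))))
            Skip
            (Seq (RSet 3 (iget0 3) (rget0 4)) (ISet 8 (iget0 3) (iget0 7)))))).

(** The bound is compared in the reals because naturals have no product. The guard admits 1000 k + 1
    rounds; the first sees zero weights only and picks point 0. *)
Definition seeding : cmd :=
  loop 7 (RLe (RNat (iget0 7)) (RMul (rpow (RNat (IConst 10)) 3) (RNat (iget0 2))))
    (Seq (sample 3) add_seed).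

Definition weights : cmd :=
  let own := IGet 8 (iget0 3) in
  Seq (loop 3 (below 3 (iget0 0))
        (Seq (ISet 9 own (IAdd (IGet 9 own) (IConst 1)))
             (RSet 7 (IConst 0) (RAdd (rget0 7) (RGet 3 (iget0 3))))))
      (loop 3 (below 3 (iget0 0))
        (RSet 5 (iget0 3) (RAdd (RDiv (RGet 3 (iget0 3)) (rget0 7))
                             (RDiv (RNat (IConst 1)) (RNat (IGet 9 own)))))).

(** The number of known representatives is the default label: it survives when every query fails and
    then names a new cluster. *)
Definition classify : cmd :=
  Seq (ISet 16 (IConst 0) (iget0 11))
  (Seq (loop 12 (below 12 (iget0 11))
         (Seq (Query 13 (IConst 0) (iget0 5) (IGet 10 (iget0 12)))
              (If (ILe (IConst 1) (iget0 13)) (ISet 16 (IConst 0) (iget0 12)) Skip)))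
       (If (ILe (iget0 11) (iget0 16))
          (Seq (ISet 10 (iget0 11) (iget0 5)) (incr 11)) Skip)).

(** The quotients are refreshed with every sample, so real array 2 always holds the current
    estimates and no final pass is needed. *)
Definition add_sample : cmd :=
  let ix := IAdd (IGet 15 (iget0 16)) (iget0 4) in
  let w := RGet 5 (iget0 5) in
  Seq (RSet 6 (iget0 16) (RAdd (RGet 6 (iget0 16)) (RDiv (RNat (IConst 1)) w)))
      (loop 4 (below 4 (iget0 1))
        (Seq (RSet 8 ix (RAdd (RGet 8 ix) (RDiv (pcoord (iget0 5)) w)))
             (RSet 2 ix (RDiv (RGet 8 ix) (RGet 6 (iget0 16)))))).

Definition estimate : cmd :=
  loop 14 (RLe (RMul (RNat (iget0 14)) (rpow (rget0 1) 2))
               (RMul (rpow (RNat (IConst 10)) 12) (rpow (RNat (iget0 2)) 4)))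
    (Seq (sample 5) (Seq classify add_sample)).

Definition kmeans_prog : cmd :=
  Seq offsets (Seq seeding (Seq weights estimate)).

Variables (R : realType) (orc : nat -> nat -> bool).

Lemma reval_rpow (s : state R) e m : reval s (rpow e m) = reval s e ^+ m.
Proof. by elim: m => //= m ->; rewrite exprS. Qed.

Variables (n : nat) (i0 : 'I_n).

Definition Esamp (w : 'I_n -> R) (f : 'I_n -> R) : R :=
  if 0 < \sum_i w i then \sum_i w i / (\sum_i w i) * f i else f i0.

(* Junk division 0 / 0 = 0 makes the sampler keep index 0 while the total weight is 0. *)
Lemma refines_sample wa (w : 'I_n -> R) s :
  wa != 4%N -> val i0 = 0%N -> imem s 0 0 = n -> (forall i, 0 <= w i) ->
  (forall i : 'I_n, rmem s wa i = w i) ->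
  refines orc (n * 11 + 9) (sample wa) s
    (fun i s' => imem s' 5 0 = val i /\ frame [:: 3; 5; 6]%N [:: 4]%N s s')
    (Esamp w).
Proof.
move=> wa4' i00 sn w0 sw; have wa4 : wa \notin [:: 4%N] by rewrite inE.
set W := fun m : nat => \sum_(i < n | (i < m)%N) w i.
have W0 m : 0 <= W m by apply: sumr_ge0.
have WS (i : 'I_n) : W i.+1 = W i + w i.
  rewrite /W (bigD1 i) //= addrC; congr (_ + _); apply: eq_bigl => l.
  by rewrite ltnS ltn_neqAle andbC.
set stp := fun (i : nat) (l : 'I_n) (f : 'I_n -> R) =>
  let p := clip (oapp w 0 (insub i) / W i.+1) in
  p * f (odflt i0 (insub i)) + (1 - p) * f l.
have HE f : Esamp w f <= miter stp 0 n i0 f.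
  have WT : W n = \sum_i w i by apply: eq_bigl => i; rewrite ltn_ord.
  (* Reservoir invariant: from round [i] on, the held index [l] survives with probability
     [W i / W n], and each [j >= i] is selected with probability [w j / W n]. *)
  suff H : forall r i l g, (i + r = n)%N ->
      miter stp i r l g =
      if 0 < W n then \sum_(j < n | (i <= j)%N) w j / W n * g j + W i / W n * g l
      else g l.
    rewrite H // WT /Esamp; case: ifP => // _.
    have -> : W 0%N = 0 by apply: big_pred0.
    by rewrite !mul0r addr0; apply: lexx.
  have Wle i : W i <= W n.
    by rewrite WT /W big_mkcond /=; apply: ler_sum => l _; case: ifP.
  elim=> [|r IH] i l g Hi.
    have {}Hi : i = n by lia.
    rewrite Hi /= big_pred0 => [|j]; last by rewrite leqNgt ltn_ord.
    by case: ifP => // Wn; rewrite add0r divff ?mul1r // gt_eqF.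
  have lt_i : (i < n)%N by lia.
  rewrite /= {1}/stp /= !IH; try lia.
  rewrite insubT /=; set o := Ordinal lt_i; rewrite -[i]/(val o) in Hi *.
  have -> : clip (w o / W o.+1) = w o / W o.+1.
    rewrite /clip max_r ?divr_ge0 // min_r // WS.
    have [/eqP->|Wp] := boolP (W o + w o == 0); first by rewrite invr0 mulr0.
    by rewrite ler_pdivrMr ?mul1r ?lerDr // lt_neqAle eq_sym Wp addr_ge0.
  have -> : \sum_(j < n | (o <= j)%N) w j / W n * g j =
      w o / W n * g o + \sum_(j < n | (o.+1 <= j)%N) w j / W n * g j.
    rewrite (bigD1 o) //=; congr (_ + _); apply: eq_bigl => j.
    by rewrite ltn_neqAle andbC eq_sym.
  case: ifP => [Wn|/negbT Wn].
    have [Ws|Ws] := eqVneq (W o.+1) 0.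
      have := WS o; rewrite Ws => /esym/eqP; rewrite paddr_eq0 // => /andP[/eqP-> /eqP->].
      by rewrite invr0; ring.
    set S := \sum_(j < n | _) _; rewrite (WS o) in Ws *.
    by field; rewrite Ws gt_eqF.
  have Wn0 : W n = 0 by apply/eqP; rewrite eq_le W0 leNgt Wn.
  have := Wle o.+1; rewrite Wn0 => Ws.
  have -> : W o.+1 = 0 by apply/eqP; rewrite eq_le W0 Ws.
  by rewrite invr0 mulr0; ring.
apply: (refines_mono (m' := miter stp 0 n i0)) HE.
apply: (refines_seq_run (T2 := (n * (8 + 3) + 4)%N)) => //; last by rewrite /=; lia.
apply: (refines_weaken (T := (n * (8 + 3) + 4)%N) (Q := fun (i : 'I_n) s' =>
  [/\ imem s' 5 0 = val i, rmem s' 4 0 = W n & frame [:: 3; 5; 6]%N [:: 4]%N s s']));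
  [|by []|by move=> ? ? []].
apply: (refines_loop (J := fun i (l : 'I_n) s' =>
  [/\ imem s' 5 0 = val l, rmem s' 4 0 = W i & frame [:: 3; 5; 6]%N [:: 4]%N s s'])).
- split=> //=; rewrite ?i00 //; first by rewrite /W big_pred0.
  by do 2![apply: frame_iput => //]; apply: frame_rput.
- by move=> i l s' le_i /= -> [_ _ [Hi _ _]]; rewrite (Hi 0%N) // sn addn1.
- move=> i l s1 lt_i Hi [s5 s4 Fr].
  have s1w : rmem s1 wa i = w (Ordinal lt_i).
    by case: Fr => [_ Hr _]; rewrite Hr // -sw.
  have WSi : W i.+1 = W i + w (Ordinal lt_i) := WS (Ordinal lt_i).
  apply: (refines_seq_run (T2 := 6)) => //=.
  apply: (refines_seq_le (T2 := 3) (m2 := fun v : bool => ret (if v then Ordinal lt_i else l))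
    (@refines_flip _ _ _ _ _ _)) => //.
    move=> v _ ->; apply: refines_run_post => //; rewrite /=.
    by case: v; (split; last split); rewrite /= ?Hi /upd //= ?Hi ?s1w ?s4 //;
      frame_tac.
  move=> f; rewrite /stp /ret /= insubT /= /upd /= Hi.
  rewrite (negPf wa4') s1w s4 -WSi; exact: lexx.
Qed.
End Program.

(** * Address table, squared distances and cells of the seeds *)

Section Refinement.
Set Implicit Arguments.
Unset Strict Implicit.
Variables (R : realType) (orc : nat -> nat -> bool).
Variables (n d k : nat) (eps : R) (x : 'I_n -> 'rV[R]_d).

(** The table of multiples of d serves point numbers, below n, as well as labels, at most k; hence
    the range n + k. *)
Definition input_mem (s : state R) : Prop :=
  [/\ imem s 0 0 = n, imem s 1 0 = d, imem s 2 0 = k, rmem s 1 0 = eps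
    & (forall (i : 'I_n) (j : 'I_d), rmem s 0 (i * d + j) = x i 0 j) /\
      (forall l, (l <= n + k)%N -> imem s 15 l = (l * d)%N)].

Lemma input_mem_frame li lr s s' :
  frame li lr s s' -> all [predC li] [:: 0; 1; 2; 15]%N ->
  all [predC lr] [:: 0; 1]%N -> input_mem s -> input_mem s'.
Proof.
move=> [Hi Hr _] /= /and5P[i0 i1 i2 i15 _] /and3P[r0 r1 _] [c0 c1 c2 c3 [c4 c5]].
by split; rewrite ?Hi ?Hr //; split=> *; rewrite ?Hi ?Hr ?c4 ?c5.
Qed.

Lemma refines_offsets :
  refines orc ((n + k) * 4 + 4) offsets (input k eps x)
    (fun _ s => input_mem s /\ frame [:: 3; 15]%N [::] (input k eps x) s) (ret tt).
Proof.
set s0 := input k eps x.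
apply: (refines_weaken (T := ((n + k) * (1 + 3) + 4)%N) (Q := fun _ s' =>
  (forall l, (l <= n + k)%N -> imem s' 15 l = (l * d)%N) /\
  frame [:: 3; 15]%N [::] s0 s')); [|by []|].
  apply: (refines_det_loop (J := fun i s' =>
    (forall l, (l <= i)%N -> imem s' 15 l = (l * d)%N) /\
    frame [:: 3; 15]%N [::] s0 s')).
  - split; last by frame_tac.
    by case=> // _; rewrite /= /upd /=.
  - by move=> i s le_i /= -> [_ [Hi _ _]]; rewrite !Hi //= addn1.
  - move=> i s lt_i Hi [Ho Fr]; apply: refines_run_post => //=; split; first by rewrite /upd.
    split; last by frame_tac.
    move=> l le_l; rewrite /= /upd /= Hi addn1.
    case: eqP => [->|ne]; last by apply: Ho; lia.
    by rewrite Ho //; case: Fr => [H _ _]; rewrite H //= mulSn addnC.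
move=> _ s [Ho Fr]; split=> //; case: Fr => [Hi Hr _].
split; rewrite ?Hi ?Hr //; split=> // i j; rewrite Hr //= /row_major.
have d0 : (0 < d)%N by apply: leq_ltn_trans (ltn_ord j).
rewrite divnMDl // divn_small // addn0 modnMDl modn_small //.
by rewrite !valK.
Qed.

(** Seeds are listed newest first. The value 0 on the empty list mirrors the untouched memory. *)
Fixpoint seed_dist (B : seq 'I_n) (i : 'I_n) : R :=
  if B is b :: B' then
    if (0 < size B')%N && ~~ (sqdist (x i) (x b) <= seed_dist B' i) then seed_dist B' i
    else sqdist (x i) (x b)
  else 0.

(** A cell is named by the number of seeds older than its own, so names stay valid as the list
    grows. *)
Fixpoint seed_cell (B : seq 'I_n) (i : 'I_n) : nat :=
  if B is b :: B' then
    if (0 < size B')%N && ~~ (sqdist (x i) (x b) <= seed_dist B' i) then seed_cell B' i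
    else size B'
  else 0.

Lemma refines_sqdist s (i b : 'I_n) : input_mem s ->
  imem s 3 0 = i -> imem s 5 0 = b -> rmem s 4 0 = 0 ->
  refines orc (d * 4 + 4)
   (loop 4 (below 4 (iget0 1)) (RSet 4 (IConst 0) (RAdd (rget0 4)
     (RMul (RSub (pcoord (iget0 3)) (pcoord (iget0 5))) (RSub (pcoord (iget0 3)) (pcoord (iget0 5)))))))
   s (fun _ s' => rmem s' 4 0 = sqdist (x i) (x b) /\ frame [:: 4]%N [:: 4]%N s s')
   (ret tt).
Proof.
move=> Cs s3 s5 s4.
set D := fun m : nat => \sum_(j < d | (j < m)%N) (x i 0 j - x b 0 j) ^+ 2.
have -> : sqdist (x i) (x b) = D d by apply: eq_bigl => j; rewrite ltn_ord.
apply: (refines_det_loop (T := 1) (J := fun j s' =>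
    rmem s' 4 0 = D j /\ frame [:: 4]%N [:: 4]%N s s')).
- split; last by frame_tac.
  by rewrite /= s4 /D big_pred0.
- move=> j s' le_j /= -> [_ Fr].
  by have [_ -> _ _ _] := input_mem_frame Fr isT isT Cs; rewrite addn1.
- move=> j s' lt_j Hj [HD Fr]; apply: refines_run_post => //=.
  split=> //; split; last by frame_tac.
  have [_ _ _ _ [c4 c5]] := input_mem_frame Fr isT isT Cs.
  have [Hi _ _] := Fr.
  rewrite /= /upd /= HD Hj !(Hi 3%N) // !(Hi 5%N) // s3 s5.
  rewrite !c5; try by have := ltn_ord i; have := ltn_ord b; lia.
  rewrite !(c4 _ (Ordinal lt_j)) -expr2 /D.
  rewrite [RHS](bigD1 (Ordinal lt_j)) //= addrC; congr (_ + _); apply: eq_bigl => l.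
  by rewrite ltnS andbC ltn_neqAle.
Qed.

Lemma refines_add_seed s (B : seq 'I_n) (b : 'I_n) : input_mem s ->
  imem s 5 0 = b -> imem s 7 0 = size B ->
  (forall i : 'I_n, rmem s 3 i = seed_dist B i) -> (forall i : 'I_n, imem s 8 i = seed_cell B i) ->
  refines orc (n * (d * 4 + 15) + 4) add_seed s
    (fun _ s' => [/\ forall i : 'I_n, rmem s' 3 i = seed_dist (b :: B) i,
                     forall i : 'I_n, imem s' 8 i = seed_cell (b :: B) i
                   & frame [:: 3; 4; 8]%N [:: 3; 4]%N s s']) (ret tt).
Proof.
move=> Cs s5 s7 sD sO.
apply: (refines_weaken (T := (n * (d * 4 + 12 + 3) + 4)%N) (Q := fun _ s' =>
  [/\ forall l : 'I_n, rmem s' 3 l = if (l < n)%N then seed_dist (b :: B) l else seed_dist B l,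
      forall l : 'I_n, imem s' 8 l = if (l < n)%N then seed_cell (b :: B) l else seed_cell B l
    & frame [:: 3; 4; 8]%N [:: 3; 4]%N s s'])); [|by lia|].
  apply: (refines_det_loop (J := fun i s' =>
    [/\ forall l : 'I_n, rmem s' 3 l = if (l < i)%N then seed_dist (b :: B) l else seed_dist B l,
        forall l : 'I_n, imem s' 8 l = if (l < i)%N then seed_cell (b :: B) l else seed_cell B l
      & frame [:: 3; 4; 8]%N [:: 3; 4]%N s s'])).
  - by split=> //; frame_tac.
  - move=> i s' le_i /= -> [_ _ Fr].
    by have [-> _ _ _ _] := input_mem_frame Fr isT isT Cs; rewrite addn1.
  - move=> i s1 lt_i Hi [HD HO Fr].
    apply: (refines_seq_run (T2 := (d * 4 + 10)%N)) => //; last by rewrite /=; lia.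
    set s2 := run _ _ _.
    have Fr2 : frame [:: 3; 4; 8]%N [:: 3; 4]%N s s2 by frame_tac.
    have C2 := input_mem_frame Fr2 isT isT Cs.
    have [F2 _ _] := Fr2.
    have s25 : imem s2 5 0 = b by rewrite F2.
    apply: (refines_seq_le (T2 := 5) (m2 := fun=> ret tt)
      (@refines_sqdist s2 (Ordinal lt_i) b C2 Hi s25 erefl)) => //; last by lia.
    move=> _ s3 [s34 Fr3]; apply: refines_run_post => //.
    have Fr3' : frame [:: 3; 4; 8]%N [:: 3; 4]%N s s3.
      by apply: frame_trans Fr2 _; apply: frame_sub Fr3.
    have [F3 _ _] := Fr3'.
    have [F3i F3r _] := Fr3.
    have s33 : imem s3 3 0 = i by rewrite F3i.
    have s37 : imem s3 7 0 = size B by rewrite F3.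
    have HD3 (l : 'I_n) : rmem s3 3 l = if (l < i)%N then seed_dist (b :: B) l else seed_dist B l.
      by rewrite F3r //; apply: HD.
    have HO3 (l : 'I_n) : imem s3 8 l = if (l < i)%N then seed_cell (b :: B) l else seed_cell B l.
      by rewrite F3i //; apply: HO.
    have HDi : rmem s3 3 i = seed_dist B (Ordinal lt_i) by rewrite (HD3 (Ordinal lt_i)) /= ltnn.
    have ltS (l : 'I_n) : (l < i.+1)%N = (l == Ordinal lt_i) || (l < i)%N.
      by rewrite ltnS leq_eqVlt.
    rewrite /= s34 s37 s33 HDi.
    case: ifP => Hc; split=> //; rewrite ?s33 //; split; try by frame_tac.
    + move=> l; rewrite /= HD3 ltS; case: eqP => // -> /=.
      by rewrite ltnn Hc.
    + move=> l; rewrite /= /upd /= HO3 ltS; case: eqP => // -> /=.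
      by rewrite ltnn Hc.
    + move=> l; rewrite /= /upd /= HD3 ltS; case: (eqVneq l (Ordinal lt_i)) => [->|ne] /=.
        by rewrite eqxx Hc.
      by have /negPf -> : (l != i :> nat) by [].
    + move=> l; rewrite /= /upd /= HO3 ltS; case: (eqVneq l (Ordinal lt_i)) => [->|ne] /=.
        by rewrite eqxx Hc.
      by have /negPf -> : (l != i :> nat) by [].
by move=> _ s' [HD HO Fr]; split=> // i; rewrite ?HD ?HO ltn_ord.
Qed.

End Refinement.

(** * The seeding loop and the sampling weights *)

Section Seeding.
Set Implicit Arguments.
Unset Strict Implicit.
Variables (R : realType) (orc : nat -> nat -> bool).
Variables (n d k : nat) (i0 : 'I_n) (eps : R) (x : 'I_n -> 'rV[R]_d).

Lemma sqdist_ge0 (y z : 'rV[R]_d) : 0 <= sqdist y z.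
Proof. by apply: sumr_ge0 => j _; apply: sqr_ge0. Qed.

Lemma seed_dist_ge0 B i : 0 <= seed_dist x B i.
Proof. by elim: B => //= b B IH; case: ifP => // _; apply: sqdist_ge0. Qed.

Definition seed_step (_ : nat) (B : seq 'I_n) (f : seq 'I_n -> R) : R :=
  Esamp i0 (seed_dist x B) (fun i => f (i :: B)).

Lemma refines_seeding s : val i0 = 0%N -> input_mem k eps x s ->
  (forall i, rmem s 3 i = 0) -> (forall i, imem s 8 i = 0%N) ->
  refines orc ((10 ^ 3 * k).+1 * (n * (d * 4 + 26) + 17) + 4) seeding s
    (fun B s' => [/\ size B = (10 ^ 3 * k).+1,
                     forall i : 'I_n, rmem s' 3 i = seed_dist x B i,
                     forall i : 'I_n, imem s' 8 i = seed_cell x B i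
                   & frame [:: 3; 4; 5; 6; 7; 8]%N [:: 3; 4]%N s s'])
    (miter seed_step 0 (10 ^ 3 * k).+1 [::]).
Proof.
move=> i00 Cs s3 s8; set N := (10 ^ 3 * k).+1.
apply: (refines_weaken (T := (N * ((n * 11 + 9) + (n * (d * 4 + 15) + 4) + 1 + 3) + 4)%N)
  (Q := fun B s' => [/\ size B = N,
                     forall i : 'I_n, rmem s' 3 i = seed_dist x B i,
                     forall i : 'I_n, imem s' 8 i = seed_cell x B i
                   & frame [:: 3; 4; 5; 6; 7; 8]%N [:: 3; 4]%N s s'])).
- apply: (refines_loop (J := fun i B s' => [/\ size B = i,
                     forall i : 'I_n, rmem s' 3 i = seed_dist x B i,
                     forall i : 'I_n, imem s' 8 i = seed_cell x B i
                   & frame [:: 3; 4; 5; 6; 7; 8]%N [:: 3; 4]%N s s'])).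
  + by split=> // [i|i|]; [exact: s3|exact: s8|frame_tac].
  + move=> i B s' le_i /= -> [_ _ _ Fr].
    have [_ _ -> _ _] := input_mem_frame Fr isT isT Cs.
    have -> : (10%:R : R) * (10%:R * (10%:R * 1%:R)) = (10 ^ 3)%:R by rewrite natrX; ring.
    by rewrite -natrM ler_nat.
  + move=> i B s1 lt_i Hi [sB HD HO Fr].
    have C1 := input_mem_frame Fr isT isT Cs.
    have [s1n _ _ _ _] := C1.
    have HS := refines_sample (orc := orc) (wa := 3%N) isT i00 s1n (seed_dist_ge0 B) HD.
    apply: (refines_seq_le (T2 := (n * (d * 4 + 15) + 4)%N) (m2 := fun (b : 'I_n) => ret (b :: B)) HS) => //; last by lia.
    move=> b s2 [s25 Fr2].
    have Fr2' : frame [:: 3; 4; 5; 6; 7; 8]%N [:: 3; 4]%N s s2.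
      by apply: frame_trans Fr _; apply: frame_sub Fr2.
    have C2 := input_mem_frame Fr2' isT isT Cs.
    have [F2i F2r _] := Fr2.
    have s27 : imem s2 7 0 = size B by rewrite F2i // Hi sB.
    have HD2 (l : 'I_n) : rmem s2 3 l = seed_dist x B l by rewrite F2r.
    have HO2 (l : 'I_n) : imem s2 8 l = seed_cell x B l by rewrite F2i.
    apply: refines_ret (refines_add_seed (orc := orc) C2 s25 s27 HD2 HO2) _ => s3' [HD3 HO3 Fr3].
    have [F3i F3r _] := Fr3.
    split; first by rewrite F3i // s27.
    split=> //; first by rewrite /= sB.
    apply: frame_iput => //; apply: frame_trans Fr2' _.
    by apply: frame_sub Fr3.
- by rewrite /N; nia.
- by [].
Qed.

Definition cell_size (B : seq 'I_n) (b : nat) : nat := (\sum_(l < n) (seed_cell x B l == b))%N.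

Definition weight (B : seq 'I_n) (i : 'I_n) : R :=
  seed_dist x B i / (\sum_l seed_dist x B l) + 1 / (cell_size B (seed_cell x B i))%:R.

Lemma refines_weights s B : input_mem k eps x s ->
  (forall i : 'I_n, rmem s 3 i = seed_dist x B i) -> (forall i : 'I_n, imem s 8 i = seed_cell x B i) ->
  (forall i, imem s 9 i = 0%N) -> rmem s 7 0 = 0 ->
  refines orc (n * 10 + 9) weights s
    (fun _ s' => (forall i : 'I_n, rmem s' 5 i = weight B i) /\
                 frame [:: 3; 9]%N [:: 5; 7]%N s s') (ret tt).
Proof.
move=> Cs HD HO s9 s7.
set c := fun (m b : nat) => (\sum_(l < n | (l < m)%N) (seed_cell x B l == b))%N.
set P := fun (m : nat) => \sum_(l < n | (l < m)%N) seed_dist x B l.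
have ltS m (lt_m : (m < n)%N) (l : 'I_n) :
    (l < m.+1)%N && (l != Ordinal lt_m) = (l < m)%N.
  by rewrite ltnS ltn_neqAle andbC.
have H1 : refines orc (n * (3 + 3) + 4) (loop 3 (below 3 (iget0 0))
        (Seq (ISet 9 (IGet 8 (iget0 3)) (IAdd (IGet 9 (IGet 8 (iget0 3))) (IConst 1)))
             (RSet 7 (IConst 0) (RAdd (rget0 7) (RGet 3 (iget0 3)))))) s
    (fun _ s' => [/\ forall b, imem s' 9 b = c n b, rmem s' 7 0 = P n
       & frame [:: 3; 9]%N [:: 5; 7]%N s s']) (ret tt).
  apply: (refines_det_loop (J := fun i s' => [/\ forall b, imem s' 9 b = c i b, rmem s' 7 0 = P i
       & frame [:: 3; 9]%N [:: 5; 7]%N s s'])).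
  - split; last by frame_tac.
      by move=> b; rewrite /= /upd /= s9 /c big_pred0.
    by rewrite /= s7 /P big_pred0.
  - move=> i s' le_i /= -> [_ _ Fr].
    by have [-> _ _ _ _] := input_mem_frame Fr isT isT Cs; rewrite addn1.
  - move=> i s1 lt_i Hi [Hc HP Fr]; apply: refines_run_post => //=.
    have [F1i F1r _] := Fr.
    have s18 : imem s1 8 i = seed_cell x B (Ordinal lt_i) by rewrite F1i // -HO.
    split=> //; split; last by frame_tac.
      move=> b; rewrite /= /upd /= Hi s18 !Hc /c.
      rewrite [RHS](bigD1 (Ordinal lt_i)) //= (eq_bigl _ _ (ltS i lt_i)).
      by rewrite eq_sym; case: eqP => [->|_]; rewrite ?addn1 ?add1n ?add0n.
    rewrite /= /upd /= HP Hi F1r // (HD (Ordinal lt_i)) /P.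
    by rewrite [RHS](bigD1 (Ordinal lt_i)) //= (eq_bigl _ _ (ltS i lt_i)) addrC.
apply: (refines_seq_le (T2 := (n * (1 + 3) + 4)%N) (m2 := fun=> ret tt) H1) => //; last by lia.
move=> _ s1 [Hc HP Fr].
apply: (refines_weaken (T := (n * (1 + 3) + 4)%N) (Q := fun _ s' =>
   (forall i : 'I_n, (i < n)%N -> rmem s' 5 i = weight B i) /\
   [/\ frame [:: 3; 9]%N [:: 5; 7]%N s s', forall b, imem s' 9 b = c n b & rmem s' 7 0 = P n]))
   => //; last by move=> _ s' [Hw [Fr' _ _]]; split=> // i; apply: Hw.
apply: (refines_det_loop (J := fun m s' =>
   (forall i : 'I_n, (i < m)%N -> rmem s' 5 i = weight B i) /\
   [/\ frame [:: 3; 9]%N [:: 5; 7]%N s s', forall b, imem s' 9 b = c n b & rmem s' 7 0 = P n])).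
- by split=> //; split=> //; frame_tac.
- move=> i s' le_i /= -> [_ [{}Fr _ _]].
  by have [-> _ _ _ _] := input_mem_frame Fr isT isT Cs; rewrite addn1.
- move=> i s2 lt_i Hi [Hw [{}Fr {}Hc {}HP]]; apply: refines_run_post => //=.
  split=> //; split; last by split=> //; frame_tac.
  have [F1i F1r _] := Fr.
  move=> l lt_l; rewrite /= /upd /= Hi.
  case: eqP => [El|ne]; last by apply: Hw; lia.
  have -> : l = Ordinal lt_i by apply: val_inj.
  rewrite F1r // (HD (Ordinal lt_i)) HP (F1i 8%N) // (HO (Ordinal lt_i)) Hc /weight /cell_size /c /P.
  congr (_ / _ + _ / _%:R); apply: eq_bigl => l'; by rewrite ltn_ord.
Qed.

End Seeding.

(** * Sorting samples into clusters by queries *)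

Section Estimation.
Set Implicit Arguments.
Unset Strict Implicit.
Variables (R : realType).
Variables (n d k : nat) (i0 : 'I_n) (eps : R) (x a : 'I_n -> 'rV[R]_d).
Variables (C : {fset 'rV[R]_d}) (w : 'I_n -> R).
Hypotheses (aC : forall i, a i \in C) (Ck : #|` C| = k).
Let orc := same_cluster a.

(** The machine only sees positions in this list. New centers are appended at the end so that the
    position of a known cluster never changes. *)
Fixpoint labels (S : seq 'I_n) : seq 'rV[R]_d :=
  if S is b :: S' then
    if a b \in labels S' then labels S' else rcons (labels S') (a b)
  else [::].

Lemma labels_uniq S : uniq (labels S).
Proof. by elim: S => //= b S IH; case: ifP => // Hb; rewrite rcons_uniq Hb. Qed.

Lemma mem_labels S c : (c \in labels S) = has (fun i => a i == c) S.
Proof.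
elim: S => //= b S IH; case: ifP => Hb; rewrite ?mem_rcons ?inE IH.
  by case: eqP => //= E; rewrite -IH -E.
by rewrite eq_sym.
Qed.

Lemma size_labels S : (size (labels S) <= k)%N.
Proof.
rewrite -Ck; apply: uniq_leq_size (labels_uniq S) _ => c.
by rewrite mem_labels => /hasP[i _ /eqP <-]; apply: aC.
Qed.

Lemma index_labels_cons S b i : has (fun l => a l == a i) S ->
  index (a i) (labels (b :: S)) = index (a i) (labels S).
Proof. by rewrite -mem_labels => Hi /=; case: ifP => // _; rewrite -cats1 index_cat Hi. Qed.

Lemma index_labels_head S b : index (a b) (labels (b :: S)) = index (a b) (labels S).
Proof.
rewrite /=; case: ifP => // Hb; rewrite -cats1 index_cat Hb /= eqxx addn0.
by rewrite memNindex ?Hb.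
Qed.

(** Charging [m] queries to the reference state lets [frame], which fixes the counter, describe code
    that makes queries. *)
Definition addq (s : state R) (m : nat) := State (imem s) (rmem s) (nqueries s + m).

Definition reps S (s : state R) : Prop :=
  imem s 11 0 = size (labels S) /\
  forall l, (l < size (labels S))%N ->
    exists2 i : 'I_n, imem s 10 l = i & a i = nth 0 (labels S) l.

Lemma refines_classify s S (b : 'I_n) : imem s 5 0 = b -> reps S s ->
  refines orc (k * 8 + 15) classify s
    (fun _ s' => [/\ imem s' 16 0 = index (a b) (labels S), reps (b :: S) s'
       & frame [:: 10; 11; 12; 13; 16]%N [::] (addq s (size (labels S))) s']) (ret tt).
Proof.
move=> s5 [s11 s10]; set L := labels S; have Lk : (size L <= k)%N := size_labels S.
have Lu : uniq L := labels_uniq S.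
set ix := index (a b) L.
apply: (refines_seq_run (T2 := (size L * (5 + 3) + 4 + 6)%N)) => //; last by rewrite /=; lia.
set s1 := run _ _ _.
(* Representatives lie in distinct clusters, so only the query at position [ix] can succeed. *)
have H1 : refines orc (size L * (5 + 3) + 4) (loop 12 (below 12 (iget0 11))
         (Seq (Query 13 (IConst 0) (iget0 5) (IGet 10 (iget0 12)))
              (If (ILe (IConst 1) (iget0 13)) (ISet 16 (IConst 0) (iget0 12)) Skip))) s1
  (fun _ s' => (imem s' 16 0 = if (ix < size L)%N then ix else size L) /\
     frame [:: 12; 13; 16]%N [::] (addq s (size L)) s') (ret tt).
  apply: (refines_det_loop (J := fun m s' =>
     (imem s' 16 0 = if (ix < m)%N then ix else size L) /\
     frame [:: 12; 13; 16]%N [::] (addq s m) s')).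
  - split; first by rewrite /= s11.
    by do 2![apply: frame_iput => //]; split=> //=; rewrite addn0.
  - by move=> m s' le_m /= -> [_ [Hi _ _]]; rewrite Hi //= s11 addn1.
  - move=> m s2 lt_m Hm [s216 Fr]; apply: refines_run_post => //.
    have [F2i F2r F2q] := Fr.
    have Fr' : frame [:: 12; 13; 16]%N [::] (addq s m.+1) (count_query s2).
      by split=> //=; rewrite F2q /= addnS.
    have [i s10i ai] := s10 m lt_m.
    have Eo : orc (imem s2 5 0) (imem s2 10 m) = (ix == m).
      rewrite !F2i //= s5 s10i /orc /same_cluster !valK ai /ix.
      case: eqP => [->|ne]; first by rewrite index_uniq // eqxx.
      apply/esym/eqP => Em; apply: ne.
      by rewrite -Em nth_index // -index_mem -/L Em.
    rewrite /= /upd /= Hm Eo.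
    have -> : (ix < m.+1)%N = (ix == m) || (ix < m)%N by rewrite ltnS leq_eqVlt.
    case: (eqVneq ix m) => [E|ne] /=.
      by split; rewrite //= /upd /= ?E //; split; rewrite ?Hm; [|frame_tac].
    by split; rewrite //= /upd /=; split=> //; frame_tac.
apply: (refines_seq_le (T2 := 5) (m2 := fun=> ret tt) H1) => //; last by lia.
move=> _ s2 [s216 Fr]; apply: refines_run_post => //.
have [F2i F2r F2q] := Fr.
have Fr' : frame [:: 10; 11; 12; 13; 16]%N [::] (addq s (size L)) s2.
  by apply: frame_sub Fr.
have Eix : (if (ix < size L)%N then ix else size L) = ix.
  by case: ltnP => // Hix; apply/eqP; rewrite eqn_leq Hix index_size.
rewrite Eix in s216.
have s211 : imem s2 11 0 = size L by rewrite F2i.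
have s210 l : imem s2 10 l = imem s 10 l by rewrite F2i.
have s25 : imem s2 5 0 = b by rewrite F2i.
have Hmem : (a b \in L) = (ix < size L)%N by rewrite index_mem.
rewrite /= s211 s216 leqNgt -Hmem; case: ifP => [/negPf Hb|/negbFE Hb]; split=> //.
- split; first by rewrite /= /upd /= s211 -/L Hb size_rcons addn1.
  rewrite /= -/L Hb size_rcons => l; rewrite ltnS leq_eqVlt => /predU1P[->|lt_l].
    exists b; first by rewrite /upd /= eqxx s25.
    by rewrite nth_rcons ltnn eqxx.
  have [i Hi ai] := s10 l lt_l; exists i; last by rewrite nth_rcons lt_l.
  by rewrite /upd /= s210 ltn_eqF.
- by frame_tac.
- by split; rewrite /= -/L Hb // => l /s10[i Hi ai]; exists i; rewrite ?s210.
Qed.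

Definition sums S (s : state R) : Prop :=
  [/\ forall l, rmem s 6 l = \sum_(i <- S | index (a i) (labels S) == l) 1 / w i,
      forall l (j : 'I_d), rmem s 8 (l * d + j) =
        \sum_(i <- S | index (a i) (labels S) == l) x i 0 j / w i
    & forall l (j : 'I_d),
        rmem s 2 (l * d + j) = rmem s 8 (l * d + j) / rmem s 6 l].

Lemma row_major_eq (l l' : nat) (j j' : 'I_d) :
  (l * d + j == l' * d + j')%N = (l == l') && (j == j').
Proof.
have d0 : (0 < d)%N by apply: leq_ltn_trans (ltn_ord j).
apply/eqP/andP => [E|[/eqP-> /eqP->] //].
have := congr1 (divn^~ d) E; rewrite !divnMDl // !divn_small // !addn0 => El.
by rewrite El eqxx; split=> //; move: E; rewrite El => /addnI/val_inj->.
Qed.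

Lemma big_labels_cons S b l (F : 'I_n -> R) :
  \sum_(i <- b :: S | index (a i) (labels (b :: S)) == l) F i =
  (if index (a b) (labels S) == l then F b else 0) +
  \sum_(i <- S | index (a i) (labels S) == l) F i.
Proof.
rewrite big_cons index_labels_head.
have -> : \sum_(i <- S | index (a i) (labels (b :: S)) == l) F i =
          \sum_(i <- S | index (a i) (labels S) == l) F i.
  rewrite big_seq_cond [RHS]big_seq_cond; apply: eq_bigl => i.
  case Hi: (i \in S) => //=; rewrite index_labels_cons //.
  by apply/hasP; exists i.
by case: ifP => // _; rewrite add0r.
Qed.

Lemma refines_add_sample s S (b : 'I_n) : input_mem k eps x s -> imem s 5 0 = b ->
  imem s 16 0 = index (a b) (labels S) -> (forall i : 'I_n, rmem s 5 i = w i) ->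
  sums S s ->
  refines orc (d * 6 + 6) add_sample s
    (fun _ s' => sums (b :: S) s' /\ frame [:: 4]%N [:: 2; 6; 8]%N s s') (ret tt).
Proof.
move=> Cs s5 s16 s5w [Hw Hx Ho]; set ix := index (a b) (labels S) in s16 *.
have ixk : (ix <= n + k)%N.
  exact: leq_trans (index_size _ _) (leq_trans (size_labels S) (leq_addl _ _)).
apply: (refines_seq_run (T2 := (d * (3 + 3) + 4)%N)) => //; last by rewrite /=; lia.
set s1 := run _ _ _.
have Fr1 : frame [:: 4]%N [:: 2; 6; 8]%N s s1 by frame_tac.
have Hw1 l : rmem s1 6 l = \sum_(i <- b :: S | index (a i) (labels (b :: S)) == l) 1 / w i.
  rewrite big_labels_cons /= /upd /= s16 s5 s5w !Hw -/ix eq_sym.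
  by case: eqP => [->|_]; rewrite ?add0r // addrC.
have [V HV] : exists V : nat -> R, forall l, rmem s1 6 l = V l by exists (rmem s1 6).
pose X m l (j : 'I_d) := \sum_(i <- S | index (a i) (labels S) == l) x i 0 j / w i +
  (if (ix == l) && (j < m)%N then x b 0 j / w b else 0).
(* During the loop, the coordinates of label [ix] from [m] on still hold stale quotients, computed
   before array 6 was updated. *)
apply: (refines_weaken (T := (d * (3 + 3) + 4)%N) (Q := fun _ s' =>
  [/\ forall l (j : 'I_d), rmem s' 8 (l * d + j) = X d l j,
      forall l (j : 'I_d), rmem s' 2 (l * d + j) =
       if (ix == l) && (d <= j)%N then rmem s 2 (l * d + j)
       else rmem s' 8 (l * d + j) / V l,
      forall l, rmem s' 6 l = V l
    & frame [:: 4]%N [:: 2; 6; 8]%N s s'])) => //; last first.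
  move=> _ s' [H8 H2 H6 Fr']; split=> //; split=> [l|l j|l j].
  - by rewrite H6 -HV Hw1.
  - rewrite H8 /X big_labels_cons -/ix ltn_ord andbT addrC //.
  - by rewrite H2 H6 leqNgt ltn_ord andbF.
apply: (refines_det_loop (J := fun m s' =>
  [/\ forall l (j : 'I_d), rmem s' 8 (l * d + j) = X m l j,
      forall l (j : 'I_d), rmem s' 2 (l * d + j) =
       if (ix == l) && (m <= j)%N then rmem s 2 (l * d + j)
       else rmem s' 8 (l * d + j) / V l,
      forall l, rmem s' 6 l = V l
    & frame [:: 4]%N [:: 2; 6; 8]%N s s'])).
- split=> //; last by frame_tac.
  + by move=> l j; rewrite -[LHS]/(rmem s 8 _) Hx /X ltn0 andbF addr0.
  + move=> l j; rewrite andbT; case: eqVneq => // ne.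
    by rewrite -HV /= /upd /= s16 eq_sym (negPf ne) Ho.
- move=> m s' le_m /= -> [_ _ _ Fr'].
  by have [_ -> _ _ _] := input_mem_frame Fr' isT isT Cs; rewrite addn1.
- move=> m s2 lt_m Hm [H8 H2 H6 Fr2]; apply: refines_run_post => //.
  have [F2i F2r _] := Fr2.
  have [_ _ _ _ [c4 c5]] := input_mem_frame Fr2 isT isT Cs.
  have s216 : imem s2 16 0 = ix by rewrite F2i.
  have s25 : imem s2 5 0 = b by rewrite F2i.
  have s25w : rmem s2 5 b = w b by rewrite F2r.
  pose j0 := Ordinal lt_m.
  have H8' : rmem s2 8 (ix * d + m) = X m ix j0 by rewrite (H8 ix j0).
  have pt : rmem s2 0 (b * d + m) = x b 0 j0 by rewrite (c4 b j0).
  rewrite /= s216 s25 Hm !c5; try by have := ltn_ord b; lia.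
  rewrite /upd /=.
  rewrite eqxx pt s25w H8'.
  have E l (j : 'I_d) : (l * d + j == ix * d + m)%N = (ix == l) && (j == j0).
    by rewrite (row_major_eq l ix j j0) eq_sym.
  split=> //; split=> //=; last by frame_tac.
  + move=> l j; rewrite /= /upd /= E H8 /X.
    case: eqVneq => [<-|] //=; case: eqVneq => [->|ne] /=.
      by rewrite eqxx ltnn ltnSn /= addr0.
    have -> // : (j < m.+1)%N = (j < m)%N.
    by rewrite ltnS leq_eqVlt; have /negPf -> : (j != m :> nat) by [].
  + move=> l j; rewrite /= /upd /= !E H2 H6.
    case: eqVneq => [<-|] //=; case: eqVneq => [->|ne] /=; first by rewrite ltnn.
    have -> // : (m < j)%N = (m <= j)%N.
    by rewrite ltn_neqAle eq_sym; have -> : (j != m :> nat) by [].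
Qed.

End Estimation.

(** * From the machine to a finite probabilistic model *)

Section Correctness.
Set Implicit Arguments.
Unset Strict Implicit.
Variables (R : realType).
Variables (n d k : nat) (i0 : 'I_n) (eps : R) (x a : 'I_n -> 'rV[R]_d).
Variables (C : {fset 'rV[R]_d}).
Hypotheses (aC : forall i, a i \in C) (Ck : #|` C| = k) (i00 : val i0 = 0%N).
Let orc := same_cluster a.

Definition samp_step (w : 'I_n -> R) (_ : nat) (S : seq 'I_n) (f : seq 'I_n -> R) : R :=
  Esamp i0 w (fun i => f (i :: S)).

(** Self-normalised importance sampling: the cluster sizes are unknown, so the denominator is
    estimated from the same sample. *)
Definition estimated_center (w : 'I_n -> R) (S : seq 'I_n) (c : 'rV[R]_d) : 'rV[R]_d :=
  \row_j ((\sum_(i <- S | a i == c) x i 0 j / w i) / (\sum_(i <- S | a i == c) 1 / w i)).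

Lemma estimated_center_output w S s K c : sums x a w S s -> c \in labels a S ->
  estimated_center w S c \in output d k (Config K s).
Proof.
move=> [H6 H8 H2] cS; have lk : (index c (labels a S) < k)%N.
  by apply: leq_trans (size_labels aC Ck S); rewrite index_mem.
apply/imfsetP; exists (Ordinal lk) => //; apply/rowP => j; rewrite !mxE /=.
rewrite H2 H8 H6 /=.
have E i : i \in S -> (a i == c) = (index (a i) (labels a S) == index c (labels a S)).
  move=> iS; have aS : a i \in labels a S by rewrite mem_labels; apply/hasP; exists i.
  by apply/eqP/eqP => [-> //|Ei]; rewrite -(nth_index 0 aS) Ei nth_index.
by congr (_ / _); rewrite big_seq_cond [RHS]big_seq_cond; apply: eq_bigl => i;
  case iS: (i \in S) => //=; rewrite E.
Qed.

(** The hypothesis that determines [N] is the loop guard itself, evaluated over the reals. *)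
Lemma refines_estimate N (w : 'I_n -> R) s :
  (forall m : nat, (m%:R * eps ^+ 2 <= 10 ^+ 12 * k%:R ^+ 4) = (m < N)%N) ->
  input_mem k eps x s -> (forall i, 0 <= w i) -> (forall i : 'I_n, rmem s 5 i = w i) ->
  nqueries s = 0%N -> reps a [::] s -> sums x a w [::] s ->
  refines orc (N * (n * 11 + k * 8 + d * 6 + 35) + 4) estimate s
    (fun S s' => [/\ size S = N, (nqueries s' <= N * k)%N & sums x a w S s'])
    (miter (samp_step w) 0 N [::]).
Proof.
move=> HN Cs w0 sw sq sr ss.
pose J m S s' := [/\ size S = m /\ (nqueries s' <= m * k)%N, input_mem k eps x s',
  (forall i : 'I_n, rmem s' 5 i = w i), reps a S s' & sums x a w S s'].
apply: (refines_weaken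
  (T := (N * ((n * 11 + 9) + (k * 8 + 15) + (d * 6 + 6) + 2 + 3) + 4)%N) (Q := J N)).
- apply: refines_loop.
  + by rewrite /J /= sq; split.
  + move=> m S s' le_m Hm [_ [_ _ s2 s1 _] _ _ _].
    rewrite -[LHS]/(reval s' (RNat (iget0 14)) * reval s' (rpow (rget0 1) 2) <=
      reval s' (rpow (RNat (IConst 10)) 12) * reval s' (rpow (RNat (iget0 2)) 4)).
    by rewrite !reval_rpow /iget0 /rget0 /= Hm s2 s1 HN.
  + move=> m S s1 lt_m Hm [[sS Hq] C1 Hw Hr Hs].
    have [s1n _ _ _ _] := C1.
    have HS := refines_sample (orc := orc) (wa := 5%N) isT i00 s1n w0 Hw.
    apply: (refines_seq_le (T2 := ((k * 8 + 15) + (d * 6 + 6) + 1)%N)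
      (m2 := fun (b : 'I_n) => ret (b :: S)) HS) => //; last by lia.
    move=> b s2 [s25 Fr2]; have [F2i F2r F2q] := Fr2.
    have C2 := input_mem_frame Fr2 isT isT C1.
    have Hr2 : reps a S s2.
      by case: Hr => H1 H2; split=> [|l]; rewrite F2i //; apply: H2.
    apply: (refines_seq_le (m1 := ret tt) (m2 := fun=> ret (b :: S))
      (T2 := (d * 6 + 6)%N) (refines_classify aC Ck s25 Hr2)) => //; last by lia.
    move=> _ s3 [s316 Hr3 Fr3]; have [F3i F3r F3q] := Fr3.
    have C3 : input_mem k eps x s3 by apply: input_mem_frame Fr3 isT isT C2.
    have s35 : imem s3 5 0 = b by rewrite F3i.
    have Hw3 (i : 'I_n) : rmem s3 5 i = w i by rewrite F3r //= F2r.
    have Hs3 : sums x a w S s3.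
      by case: Hs => H1 H2 H3; split=> *; rewrite !F3r //= !F2r.
    apply: refines_ret (refines_add_sample aC Ck C3 s35 s316 Hw3 Hs3) _.
    move=> s4 [Hs4 Fr4]; have [F4i F4r F4q] := Fr4.
    split; first by rewrite F4i // F3i //= F2i.
    split=> //=.
    * split; first by rewrite sS.
      by rewrite F4q F3q /= F2q; have := size_labels aC Ck S; lia.
    * by apply: (input_mem_frame (s := s4) (li := [:: 14%N]) (lr := [::])) => //;
        [apply: frame_iput|apply: input_mem_frame Fr4 isT isT C3].
    * by move=> i; rewrite F4r.
    * by case: Hr3 => H1 H2; split=> [|l]; rewrite /= /upd /= F4i //; apply: H2.
- by rewrite leq_add2r leq_mul2l; apply/orP; right; lia.
- by move=> S s' [[]].
Qed.

Lemma weight_ge0 B i : 0 <= weight x B i.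
Proof.
by rewrite addr_ge0 // divr_ge0 ?seed_dist_ge0 // ?sumr_ge0 // => l _; apply: seed_dist_ge0.
Qed.

Definition run_time N : nat :=
  ((n + k) * 4 + 4 + ((10 ^ 3 * k).+1 * (n * (d * 4 + 26) + 17) + 4) +
   (n * 10 + 9) + (N * (n * 11 + k * 8 + d * 6 + 35) + 4) + 3)%N.

Definition model N (f : seq 'I_n -> seq 'I_n -> R) : R :=
  miter (seed_step i0 x) 0 (10 ^ 3 * k).+1 [::]
    (fun B => miter (samp_step (weight x B)) 0 N [::] (f B)).

Lemma refines_kmeans N :
  (forall m : nat, (m%:R * eps ^+ 2 <= 10 ^+ 12 * k%:R ^+ 4) = (m < N)%N) ->
  refines orc (run_time N) kmeans_prog (input k eps x)
    (fun BS s' => [/\ size BS.1 = (10 ^ 3 * k).+1, size BS.2 = N, (nqueries s' <= N * k)%N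
                    & sums x a (weight x BS.1) BS.2 s'])
    (fun f => model N (fun B S => f (B, S))).
Proof.
move=> HN; rewrite /run_time.
apply: (refines_seq_le (m2 := fun _ f => model N (fun B S => f (B, S)))
  (T2 := ((10 ^ 3 * k).+1 * (n * (d * 4 + 26) + 17) + 4 +
   (n * 10 + 9) + (N * (n * 11 + k * 8 + d * 6 + 35) + 4) + 2)%N)
  (@refines_offsets _ orc _ _ k eps x)) => //; last by lia.
move=> _ s1 [C1 Fr1]; have [F1i F1r F1q] := Fr1.
apply: (refines_seq_le (m2 := fun B f => miter (samp_step (weight x B)) 0 N [::] (fun S => f (B, S)))
  (T2 := ((n * 10 + 9) + (N * (n * 11 + k * 8 + d * 6 + 35) + 4) + 1)%N)
  (refines_seeding (orc := orc) i00 C1 _ _)) => //; try by lia.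
- by move=> i; rewrite F1r.
- by move=> i; rewrite F1i //=; case: ifP.
move=> B s2 [sB HD HO Fr2]; have [F2i F2r F2q] := Fr2.
have C2 := input_mem_frame Fr2 isT isT C1.
apply: (refines_seq_le (m1 := ret tt)
  (m2 := fun _ f => miter (samp_step (weight x B)) 0 N [::] (fun S => f (B, S)))
  (T2 := (N * (n * 11 + k * 8 + d * 6 + 35) + 4)%N)
  (refines_weights (orc := orc) C2 HD HO _ _)) => //; try by lia.
- by move=> i; rewrite F2i // F1i //=; case: ifP.
- by rewrite F2r // F1r.
move=> _ s3 [Hw Fr3]; have [F3i F3r F3q] := Fr3.
have C3 := input_mem_frame Fr3 isT isT C2.
have q3 : nqueries s3 = 0%N by rewrite F3q F2q F1q.
have r3 : reps a [::] s3 by split=> //; rewrite F3i // F2i // F1i.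
have z3 : sums x a (weight x B) [::] s3.
  by split=> *; rewrite ?big_nil ?F3r // ?F2r // ?F1r //= ?mul0r.
have H := refines_estimate HN C3 (weight_ge0 B) Hw q3 r3 z3.
move=> K E T' f Hf t Ht; apply: (H K E T' (fun S => f (B, S)) _ t Ht).
by move=> S s' t' [sS Hq Hs]; apply: Hf.
Qed.

(** Only [f <= indicator] is asked for. As [f] may be negative, a Markov-type bound 1 - Z can be
    used directly. *)
Lemma prob_kmeans N (P : state R -> bool) (f : seq 'I_n -> seq 'I_n -> R) :
  (forall m : nat, (m%:R * eps ^+ 2 <= 10 ^+ 12 * k%:R ^+ 4) = (m < N)%N) ->
  (forall B S s, size B = (10 ^ 3 * k).+1 -> size S = N ->
     (nqueries s <= N * k)%N -> sums x a (weight x B) S s ->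
     f B S <= (P s)%:R) ->
  model N f <= prob orc (run_time N) (fun g => halted g && P (memory g))
    (init k kmeans_prog eps x).
Proof.
move=> HN Hf.
have H := refines_kmeans HN; apply: (H [::] _ 0%N (fun BS => f BS.1 BS.2)); last by rewrite addn0.
move=> [B S] s t [sB sS Hq Hs] _; rewrite /= in sB sS Hq Hs *.
have -> : prob orc t (fun g => halted g && P (memory g)) (Config [::] s) = (P s)%:R.
  by elim: t.
exact: Hf.
Qed.

End Correctness.

(** * Geometry of optimal clusterings *)

Section Kmeans.
Set Implicit Arguments.
Unset Strict Implicit.
Variables (R : realType) (n d k : nat) (x : 'I_n -> 'rV[R]_d).
Implicit Types (y z u c : 'rV[R]_d).

Lemma sqdistC y z : sqdist y z = sqdist z y.
Proof. by apply: eq_bigr => j _; rewrite -sqrrN opprB. Qed.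

Lemma sqdistxx y : sqdist y y = 0.
Proof. by apply: big1 => j _; rewrite subrr expr0n. Qed.

Lemma sqdist_tri u y z : sqdist y z <= 2 * sqdist y u + 2 * sqdist u z.
Proof.
rewrite /sqdist !mulr_sumr -big_split /=; apply: ler_sum => j _.
have := sqr_ge0 (y 0 j - u 0 j - (u 0 j - z 0 j)); rewrite !expr2; lra.
Qed.

Lemma min_sqdist_le (D : {fset 'rV[R]_d}) y c : c \in D -> min_sqdist D y <= sqdist y c.
Proof.
rewrite /min_sqdist -[c \in D]/(c \in enum_fset D); elim: (enum_fset D) (head 0 _) => // v s IH m.
by rewrite big_cons ge_min inE => /predU1P[->|/IH ->]; rewrite ?lexx ?orbT.
Qed.

Lemma min_sqdist_ge (D : {fset 'rV[R]_d}) y c m : c \in D ->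
  (forall u, u \in D -> m <= sqdist y u) -> m <= min_sqdist D y.
Proof.
move=> cD Hm; rewrite /min_sqdist big_seq.
elim/big_ind: _ => [|a b ma mb|u uD]; last exact: Hm.
- apply: Hm; rewrite -[_ \in D]/(_ \in enum_fset D).
  move: cD; rewrite -[c \in D]/(c \in enum_fset D).
  by case: (enum_fset D) => //= v s _; rewrite mem_head.
- by rewrite le_min ma.
Qed.

Hypothesis inj_x : injective x.

Lemma Phi_sum (D : {fset 'rV[R]_d}) :
  Phi D (dataset x) = \sum_i min_sqdist D (x i).
Proof.
rewrite /Phi /dataset big_imfset /=; last by move=> i j _ _; apply: inj_x.
by rewrite big_enum.
Qed.

Lemma Phi_ge0 (D : {fset 'rV[R]_d}) c : c \in D -> 0 <= Phi D (dataset x).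
Proof.
move=> cD; rewrite Phi_sum; apply: sumr_ge0 => i _.
by apply: (min_sqdist_ge cD) => u _; apply: sqdist_ge0.
Qed.

Lemma Phi_le (D : {fset 'rV[R]_d}) (g : 'I_n -> 'rV[R]_d) : (forall i, g i \in D) ->
  Phi D (dataset x) <= \sum_i sqdist (x i) (g i).
Proof. by move=> gD; rewrite Phi_sum; apply: ler_sum => i _; apply: min_sqdist_le. Qed.

Hypotheses (d0 : (0 < d)%N) (k0 : (0 < k)%N).

(** [Delta] ranges over sets of exactly k centers, so smaller sets must be padded. A constant row
    exceeding the sum of all absolute first coordinates is new; this is where d > 0 enters. *)
Lemma fset_extend (D : {fset 'rV[R]_d}) : (#|` D| <= k)%N ->
  exists2 D' : {fset 'rV[R]_d}, #|` D'| = k & {subset D <= D'}.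
Proof.
move=> Dk; have : exists r, (#|` D| + r = k)%N by exists (k - #|` D|)%N; lia.
case=> r; elim: r D {Dk} => [|r IH] D Dk; first by exists D => //; lia.
pose y : 'rV[R]_d := const_mx (1 + \sum_(c <- enum_fset D) `|c 0 (Ordinal d0)|).
have yD : y \notin D.
  apply/negP => yD.
  have : `|y 0 (Ordinal d0)| <= \sum_(c <- enum_fset D) `|c 0 (Ordinal d0)|.
    by rewrite (big_rem y) //= lerDl sumr_ge0.
  rewrite mxE ger0_norm; first by lra.
  by rewrite addr_ge0 // sumr_ge0.
have [|D' D'k sD] := IH (y |` D)%fset; first by rewrite cardfsU1 yD; lia.
by exists D' => // c cD; apply: sD; rewrite in_fset1U cD orbT.
Qed.

Lemma Delta_le (D : {fset 'rV[R]_d}) (g : 'I_n -> 'rV[R]_d) : (#|` D| <= k)%N ->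
  (forall i, g i \in D) -> Delta k (dataset x) <= \sum_i sqdist (x i) (g i).
Proof.
move=> /fset_extend[D' D'k sD] gD.
apply: le_trans (Phi_le (D := D') (g := g) _); last by move=> i; apply: sD.
apply: ge_inf; last by exists D'.
exists 0 => _ [E /= Ek <-].
have [E0|[c cE]] := fset_0Vmem E; last exact: Phi_ge0 cE.
by move: k0; rewrite -Ek E0 cardfs0.
Qed.

Variables (C : {fset 'rV[R]_d}) (a : 'I_n -> 'rV[R]_d).
Hypotheses (optC : optimal_centers k C (dataset x)) (vorC : voronoi C x a).

Lemma cluster_mem i : a i \in C. Proof. by have [] := vorC i. Qed.

Definition opt_cost : R := \sum_i sqdist (x i) (a i).
Definition opt_cluster_cost c : R := \sum_(i | a i == c) sqdist (x i) c.
Definition cluster_size c : R := \sum_(i < n | a i == c) 1.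

Lemma Delta_sum : Delta k (dataset x) = opt_cost.
Proof.
case: optC => Ck PhiC; apply/eqP; rewrite eq_le; apply/andP; split.
  by apply: (Delta_le (D := C)); [rewrite Ck|apply: cluster_mem].
rewrite -PhiC Phi_sum; apply: ler_sum => i _; have [aC Ha] := vorC i.
exact: min_sqdist_ge aC Ha.
Qed.

Lemma sum_clusters (F : 'I_n -> R) :
  \sum_i F i = \sum_(c <- enum_fset C) \sum_(i | a i == c) F i.
Proof.
under [RHS]eq_bigr do rewrite big_mkcond.
rewrite exchange_big /=; apply: eq_bigr => i _.
rewrite (bigD1_seq (a i)) /= ?fset_uniq ?cluster_mem // eqxx.
by rewrite big1 ?addr0 // => c ne; rewrite eq_sym (negPf ne).
Qed.

Lemma opt_cost_sum : opt_cost = \sum_(c <- enum_fset C) opt_cluster_cost c.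
Proof.
rewrite /opt_cost sum_clusters; apply: eq_bigr => c _; apply: eq_bigr => i /eqP -> //.
Qed.

Lemma opt_cluster_cost_ge0 c : 0 <= opt_cluster_cost c.
Proof. by apply: sumr_ge0 => i _; apply: sqdist_ge0. Qed.

Lemma opt_cluster_cost_le c : c \in C -> opt_cluster_cost c <= opt_cost.
Proof.
move=> cC; rewrite opt_cost_sum (bigD1_seq c) //= ?fset_uniq // lerDl.
by apply: sumr_ge0 => c' _; apply: opt_cluster_cost_ge0.
Qed.

Lemma cluster_size_ge0 c : 0 <= cluster_size c.
Proof. exact: sumr_ge0. Qed.

Lemma cluster_size_ge1 i : 1 <= cluster_size (a i).
Proof. by rewrite /cluster_size (bigD1 i) //= lerDl sumr_ge0. Qed.

(** Parallel axis identity. The centroid equation is kept free of division so that it also makes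
    sense for an empty cluster. *)
Lemma sqdist_shift c (m : 'rV[R]_d) : (forall j, m 0 j * cluster_size c = \sum_(i | a i == c) x i 0 j) ->
  forall u, \sum_(i | a i == c) sqdist (x i) u =
  \sum_(i | a i == c) sqdist (x i) m + cluster_size c * sqdist m u.
Proof.
move=> Hm u; rewrite /sqdist mulr_sumr exchange_big [in RHS]exchange_big -big_split /=.
apply: eq_bigr => j _.
have -> : cluster_size c * (m 0 j - u 0 j) ^+ 2 =
    \sum_(i | a i == c) ((m 0 j - u 0 j) ^+ 2 + 2 * (m 0 j - u 0 j) * (x i 0 j - m 0 j)).
  have E t : \sum_(i | a i == c) t = cluster_size c * t.
    by rewrite /cluster_size mulr_suml; apply: eq_bigr => i _; rewrite mul1r.
  have H0 : \sum_(i | a i == c) (x i 0 j - m 0 j) = 0.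
    by rewrite big_split /= sumrN E -Hm mulrC subrr.
  have H1 : \sum_(i | a i == c) 2 * (m 0 j - u 0 j) * (x i 0 j - m 0 j) = 0.
    by rewrite -mulr_sumr H0 mulr0.
  by rewrite big_split /= E H1 addr0.
rewrite -big_split /=; apply: eq_bigr => i _; ring.
Qed.

(** Replacing [c] by the mean [m] of its cluster lowers the cost by size times [sqdist m c], which
    optimality forces to be 0. If [m] is already a center the new set is smaller than k, which
    [Delta_le] allows. *)
Lemma centroid c : c \in C -> forall j, c 0 j * cluster_size c = \sum_(i | a i == c) x i 0 j.
Proof.
move=> cC.
have [N0|Np] := eqVneq (cluster_size c) 0.
  move=> j; rewrite N0 mulr0 big_pred0 // => i; apply/eqP => ai.
  by have := cluster_size_ge1 i; rewrite ai N0; lra.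
pose m : 'rV[R]_d := \row_j ((\sum_(i | a i == c) x i 0 j) / cluster_size c).
have Hm j : m 0 j * cluster_size c = \sum_(i | a i == c) x i 0 j by rewrite mxE divfK.
suff E : m = c by move=> j; rewrite -Hm E.
have Np' : 0 < cluster_size c by rewrite lt_neqAle eq_sym Np cluster_size_ge0.
pose g i := if a i == c then m else a i.
have Ck : #|` C| = k by case: optC.
have Dk : (#|` (m |` (C `\ c))%fset| <= k)%N.
  have := cardfsD1 c C; rewrite cC Ck => ->; rewrite cardfsU1.
  by apply: leq_add => //; apply: leq_b1.
have gD i : g i \in (m |` (C `\ c))%fset.
  rewrite /g in_fset1U in_fsetD1; case: (a i =P c) => [_|/eqP ne].
    by rewrite eqxx.
  by rewrite ne cluster_mem orbT.
have := Delta_le Dk gD; rewrite Delta_sum.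
rewrite /opt_cost (bigID (fun i => a i == c)) /= [X in _ <= X](bigID (fun i => a i == c)) /=.
have -> : \sum_(i | a i == c) sqdist (x i) (a i) = opt_cluster_cost c.
  by apply: eq_bigr => i /eqP ->.
have -> : \sum_(i | a i == c) sqdist (x i) (g i) = \sum_(i | a i == c) sqdist (x i) m.
  by apply: eq_bigr => i; rewrite /g => ->.
have -> : \sum_(i | a i != c) sqdist (x i) (g i) = \sum_(i | a i != c) sqdist (x i) (a i).
  by apply: eq_bigr => i; rewrite /g => /negPf ->.
rewrite lerD2r /opt_cluster_cost (sqdist_shift Hm c) gerDl pmulr_rle0 // => Hle.
apply/rowP => j; apply/eqP; rewrite -subr_eq0 -sqrf_eq0.
have H0 : sqdist m c = 0 by apply/eqP; rewrite eq_le Hle sqdist_ge0.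
move: H0 => /eqP; rewrite psumr_eq0 => [/allP /(_ j)|l _]; last exact: sqr_ge0.
by rewrite mem_index_enum => /(_ isT).
Qed.

Lemma opt_cluster_cost_shift c u : c \in C ->
  \sum_(i | a i == c) sqdist (x i) u = opt_cluster_cost c + cluster_size c * sqdist c u.
Proof. by move=> cC; apply: sqdist_shift; apply: centroid. Qed.

End Kmeans.

(** * Analysis of the two phases *)

Section Expectation.
Set Implicit Arguments.
Unset Strict Implicit.
Variables (R : realType) (n : nat) (i0 : 'I_n).

Lemma Esamp_mono (w f g : 'I_n -> R) : (forall i, 0 <= w i) -> (forall i, f i <= g i) ->
  Esamp i0 w f <= Esamp i0 w g.
Proof.
move=> w0 fg; rewrite /Esamp; case: ifP => // W0; apply: ler_sum => i _.
by rewrite ler_wpM2l // divr_ge0 // ltW.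
Qed.

Lemma Esamp_cst (w : 'I_n -> R) v : Esamp i0 w (fun=> v) = v.
Proof.
rewrite /Esamp; case: ifP => // W0.
by rewrite -mulr_suml -mulr_suml divff ?mul1r // gt_eqF.
Qed.

Lemma EsampD (w f g : 'I_n -> R) :
  Esamp i0 w (fun i => f i + g i) = Esamp i0 w f + Esamp i0 w g.
Proof.
rewrite /Esamp; case: ifP => // _; rewrite -big_split /=.
by apply: eq_bigr => i _; rewrite mulrDr.
Qed.

Lemma EsampZ (w f : 'I_n -> R) v : Esamp i0 w (fun i => v * f i) = v * Esamp i0 w f.
Proof.
by rewrite /Esamp; case: ifP => // _; rewrite mulr_sumr; apply: eq_bigr => i _; rewrite mulrCA.
Qed.

(** Both phases are instances up to conversion: [seed_step] with the weights [seed_dist x], and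
    [samp_step] with weights that ignore the history. *)
Definition estep (W : seq 'I_n -> 'I_n -> R) (_ : nat) (S : seq 'I_n) (f : seq 'I_n -> R) : R :=
  Esamp i0 (W S) (fun i => f (i :: S)).

Variable W : seq 'I_n -> 'I_n -> R.
Hypothesis W0 : forall S i, 0 <= W S i.
Implicit Types (m r : nat) (S : seq 'I_n).

Lemma miter_mono m r S (f g : seq 'I_n -> R) :
  (forall S', size S' = (size S + r)%N -> f S' <= g S') ->
  miter (estep W) m r S f <= miter (estep W) m r S g.
Proof.
elim: r m S => [|r IH] m S H /=; first by apply: H; rewrite addn0.
by apply: Esamp_mono => // i; apply: IH => S' /= HS; apply: H; rewrite HS addSnnS.
Qed.

Lemma miter_cst m r S v : miter (estep W) m r S (fun=> v) = v.
Proof.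
elim: r m S => //= r IH m S; rewrite /estep.
by under [X in Esamp _ _ X]funext => i do rewrite IH; rewrite Esamp_cst.
Qed.

Lemma miterD m r S (f g : seq 'I_n -> R) :
  miter (estep W) m r S (fun S => f S + g S) =
  miter (estep W) m r S f + miter (estep W) m r S g.
Proof.
elim: r m S => //= r IH m S; rewrite /estep -EsampD.
by under [X in Esamp _ _ X]funext => i do rewrite IH.
Qed.

Lemma miterZ m r S v (f : seq 'I_n -> R) :
  miter (estep W) m r S (fun S => v * f S) = v * miter (estep W) m r S f.
Proof.
elim: r m S => //= r IH m S; rewrite /estep -EsampZ.
by under [X in Esamp _ _ X]funext => i do rewrite IH.
Qed.

Lemma miter_sum (I : Type) (s : seq I) m r S (f : I -> seq 'I_n -> R) :
  miter (estep W) m r S (fun S => \sum_(c <- s) f c S) =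
  \sum_(c <- s) miter (estep W) m r S (f c).
Proof.
elim: s => [|c s IH]; rewrite ?big_nil ?big_cons.
  by under [X in miter _ _ _ _ X]funext => S' do rewrite big_nil; rewrite miter_cst.
by under [X in miter _ _ _ _ X]funext => S' do rewrite big_cons; rewrite miterD IH.
Qed.

End Expectation.

(** * The cost of the seeds *)

Section SeedingAnalysis.
Set Implicit Arguments.
Unset Strict Implicit.
Variables (R : realType) (n d k : nat) (i0 : 'I_n) (x : 'I_n -> 'rV[R]_d).
Implicit Types (B : seq 'I_n) (c : 'rV[R]_d).

Lemma seed_dist_le_head B b i : seed_dist x (b :: B) i <= sqdist (x i) (x b).
Proof. by rewrite /=; case: ifP => // /andP[_]; rewrite -ltNge => /ltW. Qed.

Lemma seed_dist_le_behead B b i : B != [::] -> seed_dist x (b :: B) i <= seed_dist x B i.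
Proof. by case: B => // b' B _; rewrite /=; case: ifP => // /negbFE. Qed.

Lemma seed_dist_le B b i : b \in B -> seed_dist x B i <= sqdist (x i) (x b).
Proof.
elim: B => // b' B IH; rewrite inE => /predU1P[->|bB]; first exact: seed_dist_le_head.
by apply: le_trans (seed_dist_le_behead _ _ _) (IH bB); case: B bB {IH}.
Qed.

Fixpoint seed_pt B (i : 'I_n) : 'I_n :=
  if B is b :: B' then
    if (0 < size B')%N && ~~ (sqdist (x i) (x b) <= seed_dist x B' i) then seed_pt B' i else b
  else i0.

Lemma seed_pt_mem B i : B != [::] -> seed_pt B i \in B.
Proof.
elim: B => // b B IH _ /=; case: ifP => [/andP[B0 _]|_]; last exact: mem_head.
by rewrite inE IH ?orbT //; case: B B0 {IH}.
Qed.

Lemma seed_dist_pt B i : B != [::] -> seed_dist x B i = sqdist (x i) (x (seed_pt B i)).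
Proof.
elim: B => // b B IH _ /=; case: ifP => [/andP[B0 _]|//].
by apply: IH; case: B B0.
Qed.

Lemma seed_cell_lt B i : B != [::] -> (seed_cell x B i < size B)%N.
Proof.
elim: B => // b B IH _ /=; case: ifP => // /andP[B0 _].
by apply: ltnW; rewrite ltnS IH //; case: B B0 {IH}.
Qed.

Lemma seed_cell_pt B i l : B != [::] -> seed_cell x B i = seed_cell x B l -> seed_pt B i = seed_pt B l.
Proof.
elim: B => // b B IH _ /=.
case: ifP => [/andP[B0 _]|_]; case: ifP => [/andP[B1 _]|_] // E.
- by apply: IH E; rewrite -size_eq0 -lt0n.
- by have := @seed_cell_lt B i; rewrite E ltnn; case: B B0 {IH E} => // ? ? _ /(_ isT).
- by have := @seed_cell_lt B l; rewrite -E ltnn; case: B B1 {IH E} => // ? ? _ /(_ isT).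
Qed.

Lemma seed_dist_lip B i l : B != [::] -> seed_dist x B i <= 2 * sqdist (x i) (x l) + 2 * seed_dist x B l.
Proof.
move=> B0; rewrite [seed_dist x B l]seed_dist_pt //.
by apply: le_trans (sqdist_tri _ _ _); apply: seed_dist_le; apply: seed_pt_mem.
Qed.

Hypotheses (inj_x : injective x) (d0 : (0 < d)%N) (k0 : (0 < k)%N).
Variables (C : {fset 'rV[R]_d}) (a : 'I_n -> 'rV[R]_d).
Hypotheses (optC : optimal_centers k C (dataset x)) (vorC : voronoi C x a).
Local Notation Dl := (opt_cost x a).
Local Notation dl := (opt_cluster_cost x a).
Local Notation nc := (cluster_size a).

Definition cluster_cost B c : R := \sum_(i | a i == c) seed_dist x B i.

Lemma cluster_cost_ge0 B c : 0 <= cluster_cost B c.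
Proof. by apply: sumr_ge0 => i _; apply: seed_dist_ge0. Qed.

Lemma cluster_sum_cst c (t : R) : \sum_(i < n | a i == c) t = nc c * t.
Proof. by rewrite /nc mulr_suml; apply: eq_bigr => i _; rewrite mul1r. Qed.

(* Arthur and Vassilvitskii: a D^2-sample inside a cluster reduces its cost to
   8 times the optimum in expectation. *)
Lemma cluster_cost_sample B c : B != [::] -> c \in C ->
  \sum_(i | a i == c) seed_dist x B i * cluster_cost (i :: B) c <= 8 * dl c * cluster_cost B c.
Proof.
move=> B0 cC; set P := cluster_cost B c.
have P0 : 0 <= P := cluster_cost_ge0 B c.
pose S i := \sum_(l | a l == c) sqdist (x l) (x i).
have SE i : S i = dl c + nc c * sqdist c (x i).
  exact: (opt_cluster_cost_shift inj_x d0 k0 optC vorC).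
have [N0|Np] := eqVneq (nc c) 0.
  rewrite big_pred0 => [|i].
    by rewrite mulr_ge0 // mulr_ge0 // opt_cluster_cost_ge0.
  by apply/eqP => ai; have := cluster_size_ge1 a i; rewrite ai N0; lra.
have Np' : 0 < nc c by rewrite lt_neqAle eq_sym Np cluster_size_ge0.
rewrite -(ler_pM2l Np') mulr_sumr.
apply: (@le_trans _ _ (\sum_(i | a i == c) 4 * P * S i)); last first.
  rewrite -mulr_sumr; under eq_bigr do rewrite SE.
  rewrite big_split /= cluster_sum_cst -mulr_sumr.
  under [X in _ + _ * X]eq_bigr do rewrite sqdistC.
  by rewrite -/(dl c) le_eqVlt; apply/orP; left; apply/eqP; ring.
apply: ler_sum => i ai; set F := cluster_cost _ _.
have F0 : 0 <= F := cluster_cost_ge0 _ c.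
have FS : F <= S i by apply: ler_sum => l _; apply: seed_dist_le_head.
have FP : F <= P by apply: ler_sum => l _; apply: seed_dist_le_behead.
have HD : nc c * seed_dist x B i <= 2 * S i + 2 * P.
  rewrite -cluster_sum_cst /S /P /cluster_cost !mulr_sumr -big_split /=.
  by apply: ler_sum => l _; rewrite [sqdist (x l) _]sqdistC; apply: seed_dist_lip.
(* In (2 S + 2 P) F, bound [F] by [P] in the first product and by [S i] in the second; this gives 4
   P S. *)
have H1 : nc c * (seed_dist x B i * F) <= (2 * S i + 2 * P) * F by rewrite mulrA ler_wpM2r.
by nra.
Qed.

(** The threshold is twice the expected cost 8 [dl c] after a sample inside the cluster, so Markov's
    inequality leaves failure probability 1/2. *)
Definition uncovered B c : R := (16 * dl c < cluster_cost B c)%R%:R.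

Definition num_uncovered B : R := \sum_(c <- enum_fset C) uncovered B c.

Definition seed_fail B : R := (32 * Dl < \sum_i seed_dist x B i)%R%:R.

(** Markov's inequality. It degenerates when [dl c] = 0, but then the expected cost is 0 and every
    term vanishes. *)
Lemma uncovered_sample B c : B != [::] -> c \in C ->
  \sum_(i | a i == c) seed_dist x B i * uncovered (i :: B) c <= cluster_cost B c / 2.
Proof.
move=> B0 cC; have H := cluster_cost_sample B0 cC.
have D0 := opt_cluster_cost_ge0 x a c; have P0 := cluster_cost_ge0 B c.
have [Dz|Dp] := eqVneq (dl c) 0.
  rewrite big1 ?divr_ge0 // => i ai.
  move: H; rewrite Dz mulr0 mul0r => H.
  have H0 : \sum_(i | a i == c) seed_dist x B i * cluster_cost (i :: B) c = 0.
    apply/eqP; rewrite eq_le H sumr_ge0 // => l _.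
    by rewrite mulr_ge0 ?seed_dist_ge0 ?cluster_cost_ge0.
  move/eqP: H0; rewrite psumr_eq0 => [/allP/(_ i)|l _]; last first.
    by rewrite mulr_ge0 ?seed_dist_ge0 ?cluster_cost_ge0.
  rewrite mem_index_enum ai => /(_ isT); rewrite mulf_eq0 => /orP[/eqP->|/eqP E].
    by rewrite mul0r.
  by rewrite /uncovered E Dz mulr0 ltxx mulr0.
have Dp' : 0 < dl c by rewrite lt_neqAle eq_sym Dp.
have D16 : 0 < 16 * dl c by lra.
rewrite -(ler_pM2l D16) mulr_sumr.
apply: (@le_trans _ _ (\sum_(i | a i == c) seed_dist x B i * cluster_cost (i :: B) c)); last by lra.
apply: ler_sum => i _; rewrite mulrCA ler_wpM2l ?seed_dist_ge0 // /uncovered.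
by case: ltP => [/ltW|_]; rewrite ?mulr1 // mulr0 cluster_cost_ge0.
Qed.

Lemma uncovered_mono B b c : B != [::] -> uncovered (b :: B) c <= uncovered B c.
Proof.
move=> B0; rewrite /uncovered ler_nat; case: ltP => // H1.
suff -> : 16 * dl c < cluster_cost B c by [].
by apply: lt_le_trans H1 _; apply: ler_sum => i _; apply: seed_dist_le_behead.
Qed.

(** Covered clusters cost at most 16 [Dl] in total, less than half of the whole. So a sample hits an
    uncovered cluster with probability at least 1/2, and then covers it with probability at least
    1/2. *)
Lemma seed_drop B : B != [::] -> 32 * Dl < \sum_i seed_dist x B i ->
  Esamp i0 (seed_dist x B) (fun i => num_uncovered (i :: B)) <= num_uncovered B - 1 / 4.
Proof.
move=> B0 HB; set P := \sum_i seed_dist x B i in HB *.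
have Dl0 : 0 <= Dl by apply: sumr_ge0 => i _; apply: sqdist_ge0.
have P0 : 0 < P by lra.
have aC := cluster_mem vorC.
(* [g i] indicates that seed [i] newly covers its own cluster; other clusters can only help. *)
pose g i := uncovered B (a i) - uncovered B (a i) * uncovered (i :: B) (a i).
have Hg i : num_uncovered (i :: B) <= num_uncovered B - g i.
  rewrite /num_uncovered !(bigD1_seq (a i)) /= ?fset_uniq ?aC //.
  set t1 := \sum_(_ <- _ | _) _; set t2 := \sum_(_ <- _ | _) _.
  have Ht : t1 <= t2 by apply: ler_sum => c _; apply: uncovered_mono.
  have := @uncovered_mono B i (a i) B0; rewrite /g /uncovered.
  by case: (_ < _); case: (_ < _) => /=; rewrite ?ler10 //; lra.
apply: le_trans (Esamp_mono i0 (seed_dist_ge0 x B) Hg) _.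
rewrite EsampD Esamp_cst lerD2l.
under [X in Esamp _ _ X]funext => i do rewrite -mulN1r.
rewrite EsampZ mulN1r lerN2 /Esamp -/P P0.
have -> : \sum_i seed_dist x B i / P * g i = (\sum_i seed_dist x B i * g i) / P.
  by rewrite mulr_suml; apply: eq_bigr => i _; rewrite mulrAC.
rewrite ler_pdivlMr // (sum_clusters vorC).
have PE : P = \sum_(c <- enum_fset C) cluster_cost B c by rewrite /P (sum_clusters vorC).
(* Covered clusters contribute a nonpositive term here, so the sum may extend over all clusters. *)
apply: (@le_trans _ _ (\sum_(c <- enum_fset C) (cluster_cost B c - 16 * dl c) / 2)).
  by rewrite -mulr_suml sumrB -PE -mulr_sumr -(opt_cost_sum vorC); lra.
rewrite big_seq [X in _ <= X]big_seq; apply: ler_sum => c cC.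
have -> : \sum_(i | a i == c) seed_dist x B i * g i = uncovered B c *
    (cluster_cost B c - \sum_(i | a i == c) seed_dist x B i * uncovered (i :: B) c).
  rewrite /cluster_cost -sumrB mulr_sumr; apply: eq_bigr => i /eqP <-.
  by rewrite /g; ring.
have := uncovered_sample B0 cC; set t := \sum_(_ | _) _; set q := cluster_cost B c => Ht.
rewrite /uncovered -/q; have := opt_cluster_cost_ge0 x a c.
by case: ltP => H H'; rewrite ?mul1r ?mul0r; lra.
Qed.

Lemma miter_seed_le1 m r B : miter (seed_step i0 x) m r B seed_fail <= 1.
Proof.
have := @miter_mono R n i0 (seed_dist x) (seed_dist_ge0 x) m r B seed_fail (fun=> 1).
rewrite miter_cst; apply=> S _; rewrite /seed_fail; by case: (_ < _); rewrite ?ler01.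
Qed.

Lemma miter_seed_fail0 m r B : B != [::] -> seed_fail B = 0 ->
  miter (seed_step i0 x) m r B seed_fail = 0.
Proof.
elim: r m B => //= r IH m B B0 HB; rewrite /seed_step.
under [X in Esamp _ _ X]funext => i.
  rewrite IH //; first by over.
  apply/eqP; move/eqP: HB; rewrite /seed_fail !pnatr_eq0 !eqb0 -!leNgt.
  by apply: le_trans; apply: ler_sum => l _; apply: seed_dist_le_behead.
by rewrite Esamp_cst.
Qed.

Lemma num_uncovered_ge0 B : 0 <= num_uncovered B.
Proof. by apply: sumr_ge0 => c _; apply: ler0n. Qed.

(** Potential argument without stopping times: each round spent above the threshold lowers the
    nonnegative [num_uncovered] by 1/4 in expectation. As cost never increases, failing after [r]
    rounds means having failed in all of them. *)
Lemma miter_seed_fail m r B : B != [::] ->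
  r%:R * miter (seed_step i0 x) m r B seed_fail <= 4 * num_uncovered B.
Proof.
elim: r m B => [|r IH] m B B0.
  by rewrite mul0r mulr_ge0 // num_uncovered_ge0.
case HB: (32 * Dl < \sum_i seed_dist x B i); last first.
  rewrite miter_seed_fail0 //; last by rewrite /seed_fail HB.
  by rewrite mulr0 mulr_ge0 // num_uncovered_ge0.
have H1 := miter_seed_le1 m r.+1 B; rewrite /= in H1 *.
set E := seed_step _ _ _ _ _ in H1 *.
have H2 : r%:R * E <= 4 * Esamp i0 (seed_dist x B) (fun i => num_uncovered (i :: B)).
  by rewrite /E /seed_step -!EsampZ; apply: Esamp_mono => i; [apply: seed_dist_ge0|apply: IH].
by have := seed_drop B0 HB; rewrite -(natr1 r) [_ * E]mulrDl; lra.
Qed.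

(** The first round deterministically picks [i0] and leaves at most k clusters uncovered. With [r] =
    1000 k the failure probability is at most 4/1000. *)
Lemma seeding_fail : val i0 = 0%N -> forall r,
  r%:R * miter (seed_step i0 x) 0 r.+1 [::] seed_fail <= 4 * k%:R.
Proof.
move=> i00 r; rewrite /= /seed_step /Esamp big1 // ltxx.
apply: le_trans (miter_seed_fail _ _ _) _ => //.
rewrite ler_pM2l //; have <- : #|` C| = k by case: optC.
rewrite -sum1_size natr_sum; apply: ler_sum => c _.
by rewrite /uncovered; case: (_ < _); rewrite ?ler01.
Qed.

End SeedingAnalysis.

(** * Sampling probabilities and badly sampled clusters *)

Section Weights.
Set Implicit Arguments.
Unset Strict Implicit.
Variables (R : realType) (n d k : nat) (i0 : 'I_n) (x : 'I_n -> 'rV[R]_d).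
Hypotheses (inj_x : injective x) (d0 : (0 < d)%N) (k0 : (0 < k)%N).
Variables (C : {fset 'rV[R]_d}) (a : 'I_n -> 'rV[R]_d).
Hypotheses (optC : optimal_centers k C (dataset x)) (vorC : voronoi C x a).
Local Notation Dl := (opt_cost x a).
Local Notation dl := (opt_cluster_cost x a).
Local Notation nc := (cluster_size a).
Variable B : seq 'I_n.
Hypothesis B0 : B != [::].
Let w := weight x B.
Let W := \sum_i w i.

Lemma cell_size_gt0 i : (0 < cell_size x B (seed_cell x B i))%N.
Proof. by rewrite /cell_size (bigD1 i) //= eqxx. Qed.

Lemma cell_sizeE p : (cell_size x B p)%:R = \sum_(l < n | seed_cell x B l == p) 1 :> R.
Proof. by rewrite /cell_size natr_sum [RHS]big_mkcond; apply: eq_bigr => l _; case: eqP. Qed.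

Lemma weight_gt0 i : 0 < w i.
Proof.
rewrite ltr_wpDl // ?divr_ge0 ?seed_dist_ge0 ?sumr_ge0 // => [l _|]; first exact: seed_dist_ge0.
by rewrite divr_gt0 // ltr0n cell_size_gt0.
Qed.

Lemma weight_sum_gt0 : 0 < W.
Proof.
rewrite /W (bigD1 i0) //= ltr_pwDl ?weight_gt0 // sumr_ge0 // => i _.
exact/ltW/weight_gt0.
Qed.

(** The distance parts sum to at most 1, and the reciprocal cell sizes to 1 over each nonempty
    cell. *)
Lemma weight_sum_le : W <= (size B).+1%:R.
Proof.
rewrite /W /w /weight big_split /= -natr1 [_ + 1]addrC; apply: lerD.
  rewrite -mulr_suml; have [->|ne] := eqVneq (\sum_i seed_dist x B i) 0; first by rewrite mul0r.
  by rewrite divff.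
have -> : \sum_i 1 / (cell_size x B (seed_cell x B i))%:R =
    \sum_(p < size B) \sum_(i < n | seed_cell x B i == p) 1 / (cell_size x B p)%:R :> R.
  under [RHS]eq_bigr do rewrite big_mkcond.
  rewrite exchange_big /=; apply: eq_bigr => i _.
  rewrite (bigD1 (Ordinal (seed_cell_lt x i B0))) //= eqxx big1 ?addr0 // => p.
  by rewrite -val_eqE /= eq_sym => /negPf ->.
have -> : (size B)%:R = \sum_(p < size B) 1 :> R by rewrite sumr_const card_ord.
apply: ler_sum => p _.
rewrite -mulr_suml -cell_sizeE.
by have [->|ne] := eqVneq (cell_size x B p)%:R (0 : R); rewrite ?mul0r // divff.
Qed.

(** [M] bounds the total weight. [Hk] yields the fourfold growth of cluster sizes, and [Hg] the
    bound on the displacement between centers. *)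
Variables (M kap gam : R).
Hypotheses (HM : (size B).+1%:R <= M) (Hk : 4 * k%:R * M <= kap)
  (Hg : 198 * k%:R * M <= gam * kap).
Hypothesis HB : \sum_i seed_dist x B i <= 32 * Dl.

Definition good c : bool := [forall i, (a i == c) ==> (W <= kap * nc c * w i)].

Lemma M_gt0 : 0 < M.
Proof. by apply: lt_le_trans HM; rewrite ltr0n. Qed.

Lemma kap_gt0 : 0 < kap.
Proof.
by apply: lt_le_trans Hk; rewrite mulr_gt0 ?M_gt0 // mulr_gt0 // ltr0n.
Qed.

Lemma opt_cost_ge0 : 0 <= Dl.
Proof. by apply: sumr_ge0 => i _; apply: sqdist_ge0. Qed.

(* The cell of a point sampled too rarely is so much larger than its cluster [c]
   that it shares many points with one big cluster [c'], whose center is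
   therefore close; the Voronoi property then makes [c] and [c'] close. *)
Lemma not_good c : c \in C -> ~~ good c ->
  exists c', [/\ c' \in C, 4 * nc c <= nc c' & nc c * sqdist c c' <= 4 * gam * Dl].
Proof.
move=> cC; rewrite negb_forall => /existsP[i]; rewrite negb_imply -ltNge => /andP[/eqP ai Hi].
have M0 := M_gt0; have K0 := kap_gt0; have D0 := opt_cost_ge0.
have kR : 1 <= k%:R :> R by rewrite ler1n.
have N0 : 0 < nc c by have := cluster_size_ge1 a i; rewrite ai; lra.
have WM : W <= M := le_trans weight_sum_le HM.
set p := seed_cell x B i; set cn : R := (cell_size x B p)%:R; have HP := HB; set P := \sum_i seed_dist x B i in HP.
have cn0 : 0 < cn by rewrite ltr0n cell_size_gt0.
have dm0 := seed_dist_ge0 x B i.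
have P0 : 0 <= P by apply: sumr_ge0 => l _; apply: seed_dist_ge0.
have KN : 0 < kap * nc c by rewrite mulr_gt0.
have wE : w i = seed_dist x B i / P + 1 / cn by [].
(* Both summands of the weight are small: [H1] puts the point near its seed, [H2] makes its cell
   large. *)
have H1 : kap * nc c * seed_dist x B i <= 32 * M * Dl.
  have [Pz|Pn] := eqVneq P 0.
    have -> : seed_dist x B i = 0.
      apply/eqP; rewrite eq_le dm0 andbT -Pz /P (bigD1 i) //= lerDl sumr_ge0 // => l _.
      exact: seed_dist_ge0.
    by rewrite mulr0 !mulr_ge0 // ltW.
  have Pp : 0 < P by rewrite lt_neqAle eq_sym Pn.
  have : kap * nc c * (seed_dist x B i / P) <= M.
    apply: le_trans WM; apply: le_trans (ltW Hi); rewrite ler_pM2l // wE lerDl.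
    by rewrite divr_ge0 // ltW.
  rewrite mulrA ler_pdivrMr // => H; apply: le_trans H _.
  by have := ler_wpM2l (ltW M0) HP; lra.
have H2 : kap * nc c <= M * cn.
  have : kap * nc c * (1 / cn) <= M.
    apply: le_trans WM; apply: le_trans (ltW Hi); rewrite ler_pM2l // wE lerDr.
    by rewrite divr_ge0.
  by rewrite mulrA mulr1 ler_pdivrMr.
pose cap c' : R := \sum_(l < n | (a l == c') && (seed_cell x B l == p)) 1.
have cap_sum : \sum_(c' <- enum_fset C) cap c' = cn.
  rewrite /cn cell_sizeE [RHS]big_mkcond [RHS](sum_clusters vorC); apply: eq_bigr => c' _.
  by rewrite /cap -big_mkcondr.
(* Pigeonhole: one of the k clusters contains at least a 1/k share of the cell. *)
have [c' c'C Hcap] : exists2 c', c' \in C & cn <= k%:R * cap c'.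
  apply: contrapT => Hno.
  have : \sum_(c' <- enum_fset C) (k%:R * cap c') < \sum_(c' <- enum_fset C) cn.
    rewrite big_seq [X in _ < X]big_seq; apply: ltr_sum.
      by apply/hasP; exists c.
    by move=> c' c'C; rewrite ltNge; apply/negP => H; apply: Hno; exists c'.
  rewrite -mulr_sumr cap_sum big_const_seq count_predT iter_addr_0.
  have -> : size (enum_fset C) = k by case: optC.
  by rewrite mulr_natl ltxx.
exists c'.
set pb := x (seed_pt i0 x B i).
have cap0 : 0 < cap c' by rewrite -(pmulr_rgt0 _ (lt_le_trans ltr01 kR)); apply: lt_le_trans Hcap.
have capn : cap c' <= nc c'.
  rewrite /cap /nc big_mkcondr; apply: ler_sum => l _; by case: ifP.
(* Sum the relaxed triangle inequality over the points common to [c'] and the cell, all served by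
   the seed [pb]; 66 = 2 * 32 + 2. *)
have H3 : cap c' * sqdist pb c' <= 66 * Dl.
  apply: (@le_trans _ _ (2 * P + 2 * dl c')); last by have := opt_cluster_cost_le vorC c'C; lra.
  apply: (@le_trans _ _ (\sum_(l | (a l == c') && (seed_cell x B l == p))
      (2 * seed_dist x B l + 2 * sqdist (x l) c'))).
    rewrite /cap mulr_suml; apply: ler_sum => l /andP[_ /eqP ol]; rewrite mul1r.
    rewrite (seed_dist_pt i0 x l B0) (seed_cell_pt i0 B0 ol) [sqdist (x l) _]sqdistC.
    exact: sqdist_tri.
  rewrite big_split /= -!mulr_sumr; apply: lerD; rewrite ler_pM2l //.
    by rewrite /P big_mkcond; apply: ler_sum => l _; case: ifP => // _; apply: seed_dist_ge0.
  by rewrite big_mkcondr; apply: ler_sum => l _; case: ifP => // _; apply: sqdist_ge0.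
have H4 : kap * nc c <= M * (k%:R * cap c').
  by apply: le_trans H2 _; rewrite ler_pM2l.
have q0 := sqdist_ge0 pb c'.
have H5 : kap * nc c * sqdist pb c' <= M * k%:R * (66 * Dl).
  apply: (@le_trans _ _ (M * (k%:R * cap c') * sqdist pb c')); first by rewrite ler_wpM2r.
  rewrite -mulrA -mulrA mulrA [_ * _ * (_ * _)]mulrC -[X in X <= _]mulrC ler_wpM2l //.
  by rewrite mulr_ge0 // ltW.
have H6 : sqdist (x i) c' <= 2 * seed_dist x B i + 2 * sqdist pb c'.
  by rewrite (seed_dist_pt i0 x i B0); apply: sqdist_tri.
(* [H1] and [H5] contribute 2 * 32 and 2 * 66, in total 196, within the 198 of [Hg]. *)
have H7 : nc c * sqdist (x i) c' <= gam * Dl.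
  rewrite -(ler_pM2l K0) mulrA.
  have Hg' := ler_wpM2r D0 Hg.
  have HMk : M * Dl <= M * k%:R * Dl.
    by rewrite ler_wpM2r // ler_peMr // ltW.
  have MkD : 0 <= M * k%:R * Dl by rewrite !mulr_ge0 // ltW.
  have := ler_wpM2l (ltW KN) H6; lra.
have [_ /(_ c' c'C) vor] := vorC i; rewrite ai in vor.
split=> //.
- rewrite -(ler_pM2l K0); have := ler_wpM2r (cluster_size_ge0 a c') Hk.
  have := ler_wpM2l (ltW M0) (ler_wpM2l (ler0n R k) capn); lra.
- have := sqdist_tri (x i) c c'; rewrite [sqdist c (x i)]sqdistC => H8.
  have H9 : sqdist c c' <= 4 * sqdist (x i) c' by lra.
  have := ler_wpM2l (ltW N0) H9; lra.
Qed.

Lemma cluster_size_le c : nc c <= n%:R.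
Proof.
have -> : n%:R = \sum_(i < n) 1 :> R by rewrite sumr_const card_ord.
by rewrite /nc big_mkcond /=; apply: ler_sum => i _; case: ifP.
Qed.

(** [not_good] is iterated; sizes grow and are bounded by n. The factor 4 closes the recursion: 2 *
    4 from the first move plus 2 * 16 / 4 from the rest is again 16. *)
Lemma good_near c : c \in C -> 1 <= nc c ->
  exists c', [/\ c' \in C, good c', nc c <= nc c' & nc c * sqdist c c' <= 16 * gam * Dl].
Proof.
have g0 : 0 <= gam.
  rewrite -(pmulr_lge0 _ kap_gt0); apply: le_trans Hg.
  by rewrite !mulr_ge0 // ltW // M_gt0.
suff H : forall m c, n%:R < nc c + m%:R -> c \in C -> 1 <= nc c ->
    exists c', [/\ c' \in C, good c', nc c <= nc c' & nc c * sqdist c c' <= 16 * gam * Dl].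
  by apply: (H n.+1); rewrite -natr1; have := cluster_size_ge0 a c; lra.
elim=> [|m IH] {}c Hm cC N1; first by have := cluster_size_le c; lra.
have [gc|ngc] := boolP (good c).
  by exists c; split=> //; rewrite sqdistxx mulr0 !mulr_ge0 ?opt_cost_ge0.
have [c1 [c1C N4 H1]] := not_good cC ngc.
have [||c2 [c2C g2 N2 H2]] := IH c1 _ c1C; try by move: Hm; rewrite -natr1; lra.
exists c2; split=> //; first by lra.
have H3 := ler_wpM2l (cluster_size_ge0 a c) (sqdist_tri c1 c c2).
have H4 := ler_wpM2r (sqdist_ge0 c1 c2) N4.
have D0 := opt_cost_ge0; lra.
Qed.

End Weights.

(** * Second moments of the weighted estimates *)

Section Concentration.
Set Implicit Arguments.
Unset Strict Implicit.
Variables (R : realType) (n d k : nat) (i0 : 'I_n) (eps : R) (x : 'I_n -> 'rV[R]_d).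
Hypotheses (inj_x : injective x) (d0 : (0 < d)%N) (k0 : (0 < k)%N) (eps0 : 0 < eps).
Variables (C : {fset 'rV[R]_d}) (a : 'I_n -> 'rV[R]_d).
Hypotheses (optC : optimal_centers k C (dataset x)) (vorC : voronoi C x a).
Local Notation Dl := (opt_cost x a).
Local Notation dl := (opt_cluster_cost x a).
Local Notation nc := (cluster_size a).
Variables (w : 'I_n -> R) (kap : R).
Hypothesis w0 : forall i, 0 < w i.
Let W := \sum_i w i.
Hypotheses (W0 : 0 < W) (kap0 : 0 < kap).
Variable gd : pred 'rV[R]_d.
Hypothesis gdP : forall c i, gd c -> a i = c -> W <= kap * nc c * w i.
Implicit Types (S : seq 'I_n) (c : 'rV[R]_d).

Lemma EsampE f : Esamp i0 w f = \sum_i w i / W * f i.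
Proof. by rewrite /Esamp -/W W0. Qed.

(** Draws are independent and [h] is centred, so cross terms vanish and each round adds one
    variance. *)
Lemma miter_sq (h : 'I_n -> R) m r S : Esamp i0 w h = 0 ->
  miter (samp_step i0 w) m r S (fun S => (\sum_(i <- S) h i) ^+ 2) =
  (\sum_(i <- S) h i) ^+ 2 + r%:R * Esamp i0 w (fun i => h i ^+ 2).
Proof.
move=> h0; elim: r m S => [|r IH] m S /=; first by rewrite mul0r addr0.
rewrite {1}/samp_step; set s := \sum_(i <- S) h i; set v := Esamp _ _ (fun i => _ ^+ 2).
have -> : (fun i => miter (samp_step i0 w) m.+1 r (i :: S)
      (fun S => (\sum_(i <- S) h i) ^+ 2)) =
    (fun i => h i ^+ 2 + (2 * s * h i + (s ^+ 2 + r%:R * v))).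
  by apply: funext => i; rewrite IH big_cons -/s -/v; ring.
by rewrite EsampD EsampD EsampZ Esamp_cst h0 -/v -(natr1 r); ring.
Qed.

(** Each sample adds [nc c / W] to the mass in expectation; [hdev] subtracts this. [gvar] is already
    centred, since [c] is the centroid of its cluster. *)
Definition mass c S : R := \sum_(i <- S | a i == c) 1 / w i.
Definition hdev c i : R := (a i == c)%:R / w i - nc c / W.
Definition dev c S : R := \sum_(i <- S) hdev c i.
Definition gvar c j i : R := (a i == c)%:R * (x i 0 j - c 0 j) / w i.
Definition var c S : R := \sum_j (\sum_(i <- S) gvar c j i) ^+ 2.

Lemma mass_dev c S : mass c S = dev c S + (size S)%:R * (nc c / W).
Proof.
rewrite /mass /dev /hdev; elim: S => [|i S IH]; first by rewrite !big_nil mul0r addr0.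
rewrite !big_cons IH /= -natr1; case: eqP => _ /=; first by ring.
by rewrite mul0r; ring.
Qed.

Lemma Esamp_cluster c (f : 'I_n -> R) :
  Esamp i0 w (fun i => (a i == c)%:R * f i / w i) = (\sum_(i | a i == c) f i) / W.
Proof.
rewrite EsampE mulr_suml [RHS]big_mkcond /=; apply: eq_bigr => i _.
have wi := w0 i; case: eqP => _ /=; last by rewrite !mul0r mulr0.
by rewrite mul1r; field; rewrite !gt_eqF.
Qed.

Lemma Esamp_hdev c : Esamp i0 w (hdev c) = 0.
Proof.
rewrite EsampD Esamp_cst.
under [X in Esamp _ _ X]funext => i do rewrite -[(a i == c)%:R]mulr1.
by rewrite Esamp_cluster subrr.
Qed.

Lemma Esamp_gvar c j : c \in C -> Esamp i0 w (gvar c j) = 0.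
Proof.
move=> cC; rewrite Esamp_cluster sumrB (cluster_sum_cst a c).
by rewrite -(centroid inj_x d0 k0 optC vorC cC) [nc c * _]mulrC subrr mul0r.
Qed.

(** One factor 1 / [w i] cancels against the sampling probability; goodness bounds the other by
    [kap * nc c / W]. *)
Lemma Esamp_sq_le c (f : 'I_n -> R) : gd c ->
  Esamp i0 w (fun i => ((a i == c)%:R * f i / w i) ^+ 2) <=
  kap * nc c / W ^+ 2 * \sum_(i | a i == c) f i ^+ 2.
Proof.
move=> gc; rewrite EsampE mulr_sumr [X in _ <= X]big_mkcond /=.
apply: ler_sum => i _; have wi := w0 i.
case: (a i =P c) => ai /=; last by rewrite !mul0r expr0n mulr0.
have Hi := gdP gc ai.
have -> : w i / W * (1 * f i / w i) ^+ 2 = f i ^+ 2 / (W * w i).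
  by field; rewrite !gt_eqF.
rewrite mulrC ler_wpM2r ?sqr_ge0 // -[X in X <= _]mul1r ler_pdivrMr ?mulr_gt0 //.
have -> : kap * nc c / W ^+ 2 * (W * w i) = kap * nc c * w i / W.
  by field; rewrite gt_eqF.
by rewrite ler_pdivlMr // mul1r.
Qed.

Lemma miter_dev c N : gd c ->
  miter (samp_step i0 w) 0 N [::] (fun S => dev c S ^+ 2) <=
  N%:R * (kap * nc c ^+ 2 / W ^+ 2).
Proof.
move=> gc; rewrite /dev miter_sq ?Esamp_hdev // big_nil expr0n add0r.
rewrite ler_wpM2l //; set nu := nc c / W.
have E : Esamp i0 w (fun i => ((a i == c)%:R * 1 / w i) ^+ 2) =
    Esamp i0 w (fun i => hdev c i ^+ 2) + nu ^+ 2.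
  have -> : (fun i => ((a i == c)%:R * 1 / w i) ^+ 2) =
      (fun i => hdev c i ^+ 2 + (2 * nu * hdev c i + nu ^+ 2)).
    by apply: funext => i; rewrite /hdev -/nu; ring.
  by rewrite !EsampD EsampZ Esamp_cst Esamp_hdev mulr0 add0r.
have := Esamp_sq_le (fun=> 1) gc; rewrite E expr1n -/(nc c) => H.
have -> : kap * nc c ^+ 2 / W ^+ 2 = kap * nc c / W ^+ 2 * nc c by ring.
by apply: le_trans H; rewrite lerDl sqr_ge0.
Qed.

Lemma miter_var c N : c \in C -> gd c ->
  miter (samp_step i0 w) 0 N [::] (var c) <=
  N%:R * (kap * nc c * dl c / W ^+ 2).
Proof.
move=> cC gc; rewrite /var (@miter_sum R n i0 (fun=> w)).
have -> : kap * nc c * dl c / W ^+ 2 = kap * nc c / W ^+ 2 * dl c by ring.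
rewrite /opt_cluster_cost exchange_big /= mulr_sumr mulr_sumr; apply: ler_sum => j _.
rewrite -[miter _ _ _ _ _]/(miter (samp_step i0 w) 0 N [::]
  (fun S => (\sum_(i <- S) gvar c j i) ^+ 2)).
rewrite miter_sq ?Esamp_gvar // big_nil expr0n add0r ler_wpM2l //.
exact: Esamp_sq_le.
Qed.

Lemma sqdist_estimated_center c S : mass c S != 0 -> sqdist (estimated_center x a w S c) c = var c S / mass c S ^+ 2.
Proof.
move=> m0; rewrite /sqdist /var mulr_suml; apply: eq_bigr => j _.
rewrite -expr_div_n; congr (_ ^+ 2); rewrite mxE -/(mass c S).
have -> : \sum_(i <- S) gvar c j i =
    \sum_(i <- S | a i == c) x i 0 j / w i - c 0 j * mass c S.
  rewrite /mass mulr_sumr -sumrB [RHS]big_mkcond /=; apply: eq_bigr => i _.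
  by rewrite /gvar; case: eqP => _ /=; [ring|rewrite !mul0r].
by rewrite mulrBl mulfK.
Qed.

Lemma mass_labels c S : mass c S != 0 -> c \in labels a S.
Proof.
rewrite mem_labels; apply: contraNT => /hasPn H.
by rewrite /mass big_seq_cond big1 // => i /andP[/H/negPf->].
Qed.

Lemma half_le_add (u v : R) : 0 < v -> 4 * u ^+ 2 < v ^+ 2 -> v / 2 <= u + v.
Proof.
move=> v0 H; rewrite leNgt; apply/negP => uv.
have H1 : 0 <= - u - v / 2 by lra.
have H2 : 0 <= - u + v / 2 by lra.
by have := mulr_ge0 H1 H2; rewrite !expr2 in H; lra.
Qed.

(** This is [nc c * var c S / (nu / 2) ^+ 2] with [nu] the expected mass: the cost of the estimated
    center's displacement when the mass is at least half its mean. *)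
Definition errc N c S : R := 4 * W ^+ 2 / (N%:R ^+ 2 * nc c) * var c S.

(* At [Dl = 0] the second term vanishes by the convention 0^-1 = 0; all points
   then coincide with their centers. *)
Definition failure_bound N S : R :=
  \sum_(c <- enum_fset C | gd c) 4 * W ^+ 2 / (N%:R ^+ 2 * nc c ^+ 2) * dev c S ^+ 2 +
  4 * k%:R / (eps * Dl) * \sum_(c <- enum_fset C | gd c) errc N c S.

Lemma var_ge0 c S : 0 <= var c S.
Proof. by apply: sumr_ge0 => j _; apply: sqr_ge0. Qed.

Lemma errc_ge0 N c S : 0 <= errc N c S.
Proof. by rewrite mulr_ge0 ?var_ge0 // divr_ge0 // mulr_ge0 ?sqr_ge0 ?cluster_size_ge0. Qed.

Lemma failure_bound_ge0 N S : 0 <= failure_bound N S.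
Proof.
apply: addr_ge0.
  apply: sumr_ge0 => c _.
  by rewrite mulr_ge0 ?sqr_ge0 // divr_ge0 // mulr_ge0 ?sqr_ge0.
apply: mulr_ge0; last by apply: sumr_ge0 => c _; apply: errc_ge0.
by rewrite divr_ge0 ?mulr_ge0 ?opt_cost_ge0 // ltW.
Qed.

(** Each of the k mass terms contributes 4 [kap] / N. The expected errors are proportional to the
    cluster costs and so sum to at most 4 [kap] / N times [Dl], which the prefactor normalises. *)
Lemma miter_failure_bound N : (0 < N)%N ->
  miter (samp_step i0 w) 0 N [::] (failure_bound N) <= 4 * k%:R * kap / N%:R * (1 + 4 / eps).
Proof.
move=> N0; have NR : 0 < N%:R :> R by rewrite ltr0n.
have w0' (S : seq 'I_n) i : 0 <= w i by apply: ltW.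
have D0 : 0 <= Dl := opt_cost_ge0 x a.
have Ck : size (enum_fset C) = k by case: optC.
pose Dv S := \sum_(c <- enum_fset C)
  (if gd c then 4 * W ^+ 2 / (N%:R ^+ 2 * nc c ^+ 2) else 0) * dev c S ^+ 2.
pose Er S := \sum_(c <- enum_fset C)
  (if gd c then 4 * W ^+ 2 / (N%:R ^+ 2 * nc c) else 0) * var c S.
have -> : failure_bound N = (fun S => Dv S + 4 * k%:R / (eps * Dl) * Er S).
  apply: funext => S; rewrite /failure_bound /Dv /Er !(big_mkcond gd) /=.
  by congr (_ + _ * _); apply: eq_bigr => c _; case: ifP => //; rewrite mul0r.
rewrite [miter _ _ _ _ _](@miterD R n i0 (fun=> w)) (@miterZ R n i0 (fun=> w)).
rewrite mulrDr mulr1; apply: lerD.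
  rewrite (@miter_sum R n i0 (fun=> w)).
  apply: (@le_trans _ _ (\sum_(c <- enum_fset C) 4 * kap / N%:R)); last first.
    by rewrite big_const_seq count_predT iter_addr_0 Ck -[_ *+ k]mulr_natl le_eqVlt;
      apply/orP; left; apply/eqP; ring.
  apply: ler_sum => c _; rewrite (@miterZ R n i0 (fun=> w)).
  case: ifP => gc; last by rewrite mul0r !mulr_ge0 ?invr_ge0 // ltW.
  have [nz|np] := eqVneq (nc c) 0.
    by rewrite nz expr0n /= mulr0 invr0 mulr0 mul0r !mulr_ge0 ?invr_ge0 // ltW.
  have c0 : 0 <= 4 * W ^+ 2 / (N%:R ^+ 2 * nc c ^+ 2).
    by rewrite divr_ge0 // mulr_ge0 ?sqr_ge0.
  apply: le_trans (ler_wpM2l c0 (miter_dev N gc)) _.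
  rewrite le_eqVlt; apply/orP; left; apply/eqP; field.
  by rewrite np !gt_eqF.
have HE : miter (samp_step i0 w) 0 N [::] Er <= 4 * kap / N%:R * Dl.
  rewrite [miter _ _ _ _ _](@miter_sum R n i0 (fun=> w)) (opt_cost_sum vorC) mulr_sumr.
  rewrite big_seq [X in _ <= X]big_seq.
  apply: ler_sum => c cC; rewrite (@miterZ R n i0 (fun=> w)).
  have dl0 := opt_cluster_cost_ge0 x a c.
  case: ifP => gc; last by rewrite mul0r !mulr_ge0 ?invr_ge0 // ltW.
  have [nz|np] := eqVneq (nc c) 0.
    by rewrite nz mulr0 invr0 mulr0 mul0r !mulr_ge0 ?invr_ge0 // ltW.
  have c0 : 0 <= 4 * W ^+ 2 / (N%:R ^+ 2 * nc c).
    by rewrite divr_ge0 // mulr_ge0 ?sqr_ge0 ?cluster_size_ge0.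
  apply: le_trans (ler_wpM2l c0 (miter_var N cC gc)) _.
  rewrite le_eqVlt; apply/orP; left; apply/eqP; field.
  by rewrite np !gt_eqF.
have [Dz|Dn] := eqVneq Dl 0.
  rewrite Dz mulr0 invr0 mulr0 mul0r !mulr_ge0 ?invr_ge0 //; exact: ltW.
have Dp : 0 < Dl by rewrite lt_neqAle eq_sym Dn.
have c0 : 0 <= 4 * k%:R / (eps * Dl).
  by rewrite !mulr_ge0 ?invr_ge0 // mulr_ge0 // ltW.
apply: le_trans (ler_wpM2l c0 HE) _.
rewrite le_eqVlt; apply/orP; left; apply/eqP; field.
by rewrite !gt_eqF.
Qed.

Variable gam : R.
Hypothesis near : forall c, c \in C -> 1 <= nc c ->
  exists c', [/\ c' \in C, gd c', nc c <= nc c' & nc c * sqdist c c' <= 16 * gam * Dl].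
Hypotheses (gam0 : 0 <= gam) (Hgam : 64 * k%:R * gam <= eps).

(** Every cluster is served by the estimate for a nearby good cluster. Several may share one, so the
    whole of [Err] is charged to each: k (32 [gam] [Dl] + 2 [Err]) is at most (eps/2 + eps/2)
    [Dl]. *)
Lemma failure_bound_success N S (O : {fset 'rV[R]_d}) : (0 < N)%N -> size S = N -> failure_bound N S < 1 ->
  (forall c, c \in labels a S -> estimated_center x a w S c \in O) ->
  Phi O (dataset x) <= (1 + eps) * Delta k (dataset x).
Proof.
move=> N0 sS Z1 HO; have NR : 0 < N%:R :> R by rewrite ltr0n.
have D0 : 0 <= Dl := opt_cost_ge0 x a.
have kR : 1 <= k%:R :> R by rewrite ler1n.
have Ck : size (enum_fset C) = k by case: optC.
set Err := \sum_(c <- enum_fset C | gd c) errc N c S.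
have Err0 : 0 <= Err by apply: sumr_ge0 => c _; apply: errc_ge0.
have T0 c : 0 <= 4 * W ^+ 2 / (N%:R ^+ 2 * nc c ^+ 2) * dev c S ^+ 2.
  by rewrite mulr_ge0 ?sqr_ge0 // divr_ge0 // mulr_ge0 ?sqr_ge0.
have T20 : 0 <= 4 * k%:R / (eps * Dl) * Err.
  by rewrite !mulr_ge0 ?invr_ge0 // mulr_ge0 // ltW.
have HErr : 4 * k%:R * Err <= eps * Dl.
  have [Dz|Dn] := eqVneq Dl 0.
    suff -> : Err = 0 by rewrite Dz !mulr0.
    apply: big1_seq => c /andP[_ cC]; rewrite /errc /var big1 ?mulr0 // => j _.
    rewrite big1 ?expr0n // => i _; rewrite /gvar; case: (a i =P c) => [ai|_]; last by rewrite !mul0r.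
    have /eqP : Dl = 0 := Dz; rewrite /opt_cost psumr_eq0 => [/allP/(_ i)|l _]; last exact: sqdist_ge0.
    rewrite mem_index_enum => /(_ isT) /=; rewrite psumr_eq0 => [/allP/(_ j)|l _]; last exact: sqr_ge0.
    by rewrite mem_index_enum => /(_ isT) /=; rewrite sqrf_eq0 ai => /eqP->; rewrite mulr0 mul0r.
  have Dp : 0 < eps * Dl by rewrite mulr_gt0 // lt_neqAle eq_sym Dn.
  have : 4 * k%:R / (eps * Dl) * Err <= 1.
    apply: le_trans (ltW Z1); rewrite /failure_bound -/Err lerDr.
    by apply: sumr_ge0 => c _; apply: T0.
  by rewrite mulrAC ler_pdivrMr // mul1r.
have good_est c : c \in C -> gd c -> 1 <= nc c ->
    c \in labels a S /\ nc c * sqdist (estimated_center x a w S c) c <= Err.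
  move=> cC gc n1; have n0 : 0 < nc c by lra.
  set nu := N%:R * (nc c / W).
  have nu0 : 0 < nu by rewrite mulr_gt0 // divr_gt0.
  have Hd : 4 * dev c S ^+ 2 < nu ^+ 2.
    have : 4 * W ^+ 2 / (N%:R ^+ 2 * nc c ^+ 2) * dev c S ^+ 2 < 1.
      apply: le_lt_trans Z1; rewrite /failure_bound -/Err big_mkcond (bigD1_seq c) /= ?fset_uniq //.
      by rewrite gc -addrA lerDl addr_ge0 // sumr_ge0 // => c' _; case: ifP.
    have -> : 4 * W ^+ 2 / (N%:R ^+ 2 * nc c ^+ 2) * dev c S ^+ 2 =
        4 * dev c S ^+ 2 / nu ^+ 2 by rewrite /nu; field; rewrite !gt_eqF.
    by rewrite ltr_pdivrMr ?exprn_gt0 // mul1r.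
  have Hm : nu / 2 <= mass c S.
    by rewrite mass_dev sS -/nu; apply: half_le_add nu0 Hd.
  have m0 : 0 < mass c S by lra.
  split; first by apply: mass_labels; rewrite gt_eqF.
  rewrite sqdist_estimated_center ?gt_eqF //.
  apply: (@le_trans _ _ (errc N c S)); last first.
    rewrite /Err big_mkcond (bigD1_seq c) /= ?fset_uniq // gc lerDl sumr_ge0 // => c' _.
    by case: ifP => // _; apply: errc_ge0.
  have -> : errc N c S = nc c * (var c S / (nu / 2) ^+ 2).
    by rewrite /errc /nu; field; rewrite !gt_eqF.
  rewrite ler_pM2l // ler_wpM2l ?var_ge0 // lef_pV2 ?posrE ?exprn_gt0 ?divr_gt0 //.
  by rewrite lerXn2r ?nnegrE // ltW // divr_gt0.
have near' c : exists c', c \in C -> 1 <= nc c ->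
    [/\ c' \in C, gd c', nc c <= nc c' & nc c * sqdist c c' <= 16 * gam * Dl].
  have [/andP[cC n1]|H] := boolP ((c \in C) && (1 <= nc c)).
    by have [c' Hc'] := near cC n1; exists c'.
  by exists c => cC n1; rewrite cC n1 in H.
have [f Hf] := choice near'.
pose g i := estimated_center x a w S (f (a i)).
have gO i : g i \in O.
  have [fC fg fn _] := Hf (a i) (cluster_mem vorC i) (cluster_size_ge1 a i).
  apply: HO; have [] // := good_est _ fC fg.
  exact: le_trans (cluster_size_ge1 a i) fn.
apply: le_trans (Phi_le inj_x gO) _.
rewrite (Delta_sum inj_x d0 k0 optC vorC) (sum_clusters vorC).
apply: (@le_trans _ _ (\sum_(c <- enum_fset C) (dl c + (32 * gam * Dl + 2 * Err)))); last first.
  rewrite big_split /= -(opt_cost_sum vorC) big_const_seq count_predT iter_addr_0 Ck -mulr_natr.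
  have := ler_wpM2r D0 Hgam; lra.
rewrite big_seq [X in _ <= X]big_seq; apply: ler_sum => c cC.
rewrite (eq_bigr (fun i => sqdist (x i) (estimated_center x a w S (f c)))); last by move=> i /eqP <-.
rewrite (opt_cluster_cost_shift inj_x d0 k0 optC vorC _ cC) lerD2l.
have [n1|n1] := boolP (1 <= nc c); last first.
  suff -> : nc c = 0 by rewrite mul0r addr_ge0 // !mulr_ge0.
  apply: big_pred0 => i; apply/eqP => ai.
  by rewrite -ai cluster_size_ge1 in n1.
have [fC fg fn fd] := Hf c cC n1.
have [_ Hest] := good_est _ fC fg (le_trans n1 fn).
have H1 := ler_wpM2l (cluster_size_ge0 a c) (sqdist_tri (f c) c (estimated_center x a w S (f c))).
rewrite sqdistC in Hest.
have H2 := ler_wpM2r (sqdist_ge0 (f c) (estimated_center x a w S (f c))) fn.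
by lra.
Qed.

End Concentration.

(** * Constants and success probability *)

Section Success.
Set Implicit Arguments.
Unset Strict Implicit.
Variables (R : realType) (n d k : nat) (i0 : 'I_n) (eps : R) (x : 'I_n -> 'rV[R]_d).
Hypotheses (inj_x : injective x) (d0 : (0 < d)%N) (k0 : (0 < k)%N).
Hypotheses (eps0 : 0 < eps) (eps_le : eps <= 1 / 2) (i00 : val i0 = 0%N).
Variables (C : {fset 'rV[R]_d}) (a : 'I_n -> 'rV[R]_d).
Hypotheses (optC : optimal_centers k C (dataset x)) (vorC : voronoi C x a).
Variable N : nat.
Hypothesis HN : forall m : nat,
  (m%:R * eps ^+ 2 <= 10 ^+ 12 * k%:R ^+ 4) = (m < N)%N.

(** [gam] is the largest value with 64 k [gam] <= eps. The total weight is at most 1000 k + 2 <=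
    1002 k, so [gam * kap] must reach 198 * 1002 k^2 = 198396 k^2; it equals 312500 k^2. *)
Let kap : R := 20 * 10 ^+ 6 * k%:R ^+ 3 / eps.
Let gam : R := eps / (64 * k%:R).
Let Z B := failure_bound k eps x C a (weight x B) (good x a B kap) N.

(** A lower bound for the success indicator: the first factor is 0 or 1, and the second is at most 1
    and is positive only when [Z B S < 1]. *)
Definition success B S : R := (1 - seed_fail x a B) * (1 - Z B S).

Lemma k_ge1 : 1 <= k%:R :> R. Proof. by rewrite ler1n. Qed.

Lemma N_gt0 : (0 < N)%N.
Proof. by rewrite -HN mul0r mulr_ge0 ?exprn_ge0. Qed.

Lemma kappa_gt0 : 0 < kap.
Proof.
have kp : 0 < k%:R :> R by rewrite ltr0n.
by rewrite /kap divr_gt0 // mulr_gt0 ?exprn_gt0 // mulr_gt0 // exprn_gt0.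
Qed.

Lemma kap_ge : 4 * k%:R * (1002 * k%:R) <= kap.
Proof.
have k1 := k_ge1; rewrite /kap ler_pdivlMr //.
have k2 : k%:R ^+ 2 <= k%:R ^+ 3 :> R by rewrite ler_weXn2l.
have k20 : 0 <= k%:R ^+ 2 :> R by rewrite exprn_ge0.
have H : k%:R ^+ 2 * eps <= k%:R ^+ 2 * (1 / 2) :> R by rewrite ler_wpM2l.
by rewrite !expr2 in H k20 k2 *; lra.
Qed.

Lemma gam_kap : 198 * k%:R * (1002 * k%:R) <= gam * kap.
Proof.
have k1 := k_ge1.
have -> : gam * kap = 3125 * 10 ^+ 2 * k%:R ^+ 2.
  by rewrite /gam /kap; field; rewrite !gt_eqF //; lra.
by have := sqr_ge0 (k%:R : R); rewrite !expr2; lra.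
Qed.

Lemma gam_eps : 64 * k%:R * gam <= eps.
Proof.
have k1 := k_ge1; rewrite /gam mulrC divfK //.
by rewrite mulf_neq0 ?gt_eqF //; lra.
Qed.

Lemma success_prob : 99 / 100 <= model k i0 x N success.
Proof.
have k1 := k_ge1; have NR : 0 < N%:R :> R by rewrite ltr0n N_gt0.
have EZ B : miter (samp_step i0 (weight x B)) 0 N [::] (Z B) <= 1 / 1000.
  apply: le_trans (miter_failure_bound i0 inj_x d0 k0 eps0 optC vorC (weight_gt0 x B)
    (weight_sum_gt0 i0 x B) kappa_gt0 _ N_gt0) _.
    by move=> c i /forallP/(_ i) /implyP H ai; apply: H; apply/eqP.
  (* As eps <= 1/2, the bound is at most 3.6 * 10^8 k^4 / (N eps^2); the factor 10^12 in N brings it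
     below 1/1000. *)
  have HN' : 10 ^+ 12 * k%:R ^+ 4 <= N%:R * eps ^+ 2.
    by rewrite leNgt; apply/negP => /ltW; rewrite HN ltnn.
  have -> : 4 * k%:R * kap / N%:R * (1 + 4 / eps) =
      8 * 10 ^+ 7 * k%:R ^+ 4 * (eps + 4) / (N%:R * eps ^+ 2).
    by rewrite /kap; field; rewrite !gt_eqF.
  rewrite ler_pdivrMr ?mulr_gt0 ?exprn_gt0 //.
  set q := k%:R ^+ 4 in HN' *; set z := N%:R * _ in HN' *.
  have q0 : 0 <= q by rewrite exprn_ge0.
  have H : q * eps <= q * (1 / 2) by rewrite ler_wpM2l.
  by lra.
pose g B : R := 999 / 1000 * (1 - seed_fail x a B).
apply: (@le_trans _ _ (miter (seed_step i0 x) 0 (10 ^ 3 * k).+1 [::] g)); last first.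
  apply: (@miter_mono R n i0 (seed_dist x) (seed_dist_ge0 x)) => B _.
  have -> : success B = (fun S => (1 - seed_fail x a B) + (- (1 - seed_fail x a B)) * Z B S).
    by apply: funext => S; rewrite /success; ring.
  rewrite [miter _ _ _ _ _](@miterD R n i0 (fun=> weight x B)).
  rewrite (@miterZ R n i0 (fun=> weight x B)) (@miter_cst R n i0 (fun=> weight x B)).
  have {}EZ := EZ B; rewrite -[X in _ * X]/(miter (samp_step i0 (weight x B)) 0 N [::] (Z B)).
  by rewrite /g /seed_fail; case: (_ < _) => /=; lra.
have -> : g = fun B => 999 / 1000 + (- (999 / 1000)) * seed_fail x a B.
  by apply: funext => B; rewrite /g; ring.
rewrite [miter _ _ _ _ _](@miterD R n i0 (seed_dist x)) (@miter_cst R n i0 (seed_dist x)).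
rewrite (@miterZ R n i0 (seed_dist x)).
(* Seeding fails with probability at most 4/1000, and 0.999 * 0.996 exceeds 0.99. *)
have := seeding_fail inj_x d0 k0 optC vorC i00 (10 ^ 3 * k).
set v := miter _ _ _ _ _.
have -> : (10 ^ 3 * k)%:R = k%:R * 1000 :> R by rewrite natrM natrX; ring.
rewrite -mulrA [4 * _]mulrC ler_pM2l; last by lra.
by lra.
Qed.

Lemma success_sound B S s : size B = (10 ^ 3 * k).+1 -> size S = N ->
  sums x a (weight x B) S s ->
  success B S <= (Phi (output d k (Config [::] s)) (dataset x)
                  <= (1 + eps) * Delta k (dataset x))%R%:R.
Proof.
move=> sB sS Hs; rewrite /success /seed_fail.
case: ltP => HB; first by rewrite subrr mul0r ler0n.
rewrite subr0 mul1r.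
case: (lerP 1 (Z B S)) => HZ.
  by apply: le_trans (ler0n _ _); rewrite subr_le0.
have B0 : B != [::] by rewrite -size_eq0 sB.
have HM : (size B).+1%:R <= 1002 * k%:R :> R.
  have k1 := k_ge1; rewrite sB -addn2 natrD natrM natrX.
  have -> : 10%:R ^+ 3 = 1000 :> R by ring.
  by lra.
have near := good_near i0 k0 optC vorC B0 HM kap_ge gam_kap HB.
have gam0 : 0 <= gam by rewrite divr_ge0 ?mulr_ge0 // ltW.
rewrite (failure_bound_success inj_x d0 k0 eps0 optC vorC (weight_sum_gt0 i0 x B) near gam0 gam_eps
  N_gt0 sS HZ) /=; first by rewrite lerBlDr lerDl; apply: failure_bound_ge0.
move=> c; apply: estimated_center_output Hs; [exact: cluster_mem vorC|by case: optC].
Qed.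

(** With [f] = 1 the transfer to the machine makes halting and the query bound hold with probability
    1. *)
Lemma model_cst1 : model k i0 x N (fun _ _ => 1) = 1.
Proof.
rewrite /model.
have -> : (fun B => miter (samp_step i0 (weight x B)) 0 N [::] (fun=> 1)) = (fun=> 1).
  by apply: funext => B; apply: (@miter_cst R n i0 (fun=> weight x B)).
exact: (@miter_cst R n i0 (seed_dist x)).
Qed.

End Success.

(** * Running time and final bounds *)

Lemma run_time_le (n d k N : nat) : (0 < n)%N -> (0 < d)%N -> (0 < k)%N -> (0 < N)%N ->
  (run_time n d k N <= 10 ^ 3 * 10 ^ 3 * (n * d * (k * N)))%N.
Proof.
move=> n0 d0 k0 N0; rewrite /run_time.
have : (200 <= 10 ^ 3)%N by [].
(* The unary constant is generalised so that it is never computed; only [t >= 200] matters. *)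
move: (10 ^ 3)%N => t t200.
set p := (n * d * (k * N))%N.
have nd0 : (0 < n * d)%N by rewrite muln_gt0 n0.
have p1 : (n * k <= p)%N := leq_mul (leq_pmulr n d0) (leq_pmulr k N0).
have p2 : (n * d * k <= p)%N := leq_mul (leqnn _) (leq_pmulr k N0).
have p3 : (n * N <= p)%N := leq_mul (leq_pmulr n d0) (leq_pmull N k0).
have p4 : (k * N <= p)%N := leq_pmull (k * N) nd0.
have p5 : (d * N <= p)%N := leq_mul (leq_pmull d n0) (leq_pmull N k0).
have p6 : (n <= p)%N := leq_trans (leq_pmulr n k0) p1.
have p7 : (k <= p)%N := leq_trans (leq_pmulr k N0) p4.
have p8 : (N <= p)%N := leq_trans (leq_pmull N k0) p4.
have E : ((t * k).+1 * (n * (d * 4 + 26) + 17) <= t * (100 * p))%N.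
  have tk0 : (0 < t * k)%N by rewrite muln_gt0 k0 andbT; lia.
  have H1 : ((t * k).+1 <= 2 * (t * k))%N by lia.
  have nd1 : (n <= n * d)%N := leq_pmulr n d0.
  have H2 : (n * (d * 4 + 26) + 17 <= 47 * (n * d))%N by lia.
  have := leq_mul H1 H2; have := leq_mul (leqnn t) p2; lia.
have F : (N * (n * 11 + k * 8 + d * 6 + 35) <= 60 * p)%N by lia.
have G : (t * (100 * p) + 200 * p <= t * t * p)%N.
  have : (t * 100 + 200 <= t * t)%N by nia.
  by move=> /(leq_mul (leqnn p)); lia.
by lia.
Qed.

Theorem theorem3 (R : realType) :
  exists (A : cmd) (c : R),
  forall (n d k : nat) (eps : R) (x : 'I_n -> 'rV[R]_d),
    (0 < n)%N -> (0 < d)%N -> (0 < k)%N -> 0 < eps -> eps <= 1 / 2 ->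
    injective x ->
  forall (Copt : {fset 'rV[R]_d}) (a : 'I_n -> 'rV[R]_d),
    optimal_centers k Copt (dataset x) -> voronoi Copt x a ->
  exists T Q : nat,
    [/\ T%:R <= c * (n%:R * d%:R * k%:R ^+ 9 / eps ^+ 4),
        Q%:R <= c * (k%:R ^+ 9 / eps ^+ 4),
        prob (same_cluster a) T (fun g => halted g) (init k A eps x) = 1,
        prob (same_cluster a) T (fun g => (nqueries (memory g) <= Q)%N)
          (init k A eps x) = 1
      & 99 / 100 <= prob (same_cluster a) T
          (fun g => Phi (output d k g) (dataset x)
                      <= (1 + eps) * Delta k (dataset x))
          (init k A eps x)].
Proof.
(* 10^19 is 10^6, from [run_time_le], times 10^13, from the bound on k N. *)
exists kmeans_prog, (10 ^+ 19) => n d k eps x n0 d0 k0 eps0 eps_le inj_x C a optC vorC.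
pose y : R := 10 ^+ 12 * k%:R ^+ 4 / eps ^+ 2.
have k1 : 1 <= k%:R :> R by rewrite ler1n.
have y0 : 0 <= y by rewrite divr_ge0 ?mulr_ge0 ?exprn_ge0 // ltW.
(* The guard holds for the rounds 0, ..., trunc y inclusive, hence the successor. *)
pose N := (Num.trunc y).+1.
have e2 : 0 < eps ^+ 2 by rewrite exprn_gt0.
have HN (m : nat) : (m%:R * eps ^+ 2 <= 10 ^+ 12 * k%:R ^+ 4) = (m < N)%N.
  by rewrite ltnS truncn_ge_nat // ler_pdivlMr.
pose i0 : 'I_n := Ordinal n0.
have Ck : #|` C| = k by case: optC.
have aC := cluster_mem vorC.
(* As N <= y + 1 <= 2 y, k N is at most 2 * 10^12 k^5 / eps^2; k >= 1 and eps <= 1 weaken this to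
   the claimed exponents. *)
have NB : k%:R * N%:R <= 10 ^+ 13 * (k%:R ^+ 9 / eps ^+ 4).
  have Ny : N%:R <= y + 1 by rewrite -natr1 lerD2r -truncn_ge_nat.
  have y1 : 1 <= y.
    rewrite ler_pdivlMr // mul1r.
    have H1 : eps ^+ 2 <= 1 by rewrite exprn_ile1 // ?ltW //; lra.
    have H2 : 1 <= k%:R ^+ 4 :> R by rewrite exprn_ege1.
    have H3 : 1 <= 10 ^+ 12 :> R by rewrite exprn_ege1 // ler1n.
    by apply: le_trans H1 _; apply: le_trans H2 _; rewrite ler_peMl // exprn_ge0.
  have H : k%:R * y <= 10 ^+ 12 * (k%:R ^+ 9 / eps ^+ 4).
    have -> : k%:R * y = 10 ^+ 12 * (k%:R ^+ 5 / eps ^+ 2) by rewrite /y; ring.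
    rewrite ler_pM2l ?exprn_gt0 //; apply: ler_pM.
    - by rewrite exprn_ge0.
    - by rewrite invr_ge0 ltW.
    - by rewrite ler_weXn2l.
    - rewrite lef_pV2 ?posrE ?exprn_gt0 // ler_wiXn2l //; [exact: ltW|lra].
  have := ler_wpM2l (le_trans ler01 k1) Ny.
  have := ler_wpM2l (le_trans ler01 k1) y1.
  have : 0 <= k%:R ^+ 9 / eps ^+ 4 by rewrite divr_ge0 ?exprn_ge0 // ltW.
  have -> : 10 ^+ 13 = 10 * 10 ^+ 12 :> R by rewrite -exprS.
  by move: H; move: (10 ^+ 12) => t; lra.
exists (run_time n d k N), (N * k)%N.
have H1 := prob_kmeans (i0 := i0) (P := fun s => (nqueries s <= N * k)%N)
  (f := fun _ _ => 1) aC Ck erefl HN.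
have {H1}H1 : 1 <= prob (same_cluster a) (run_time n d k N)
    (fun g => halted g && (nqueries (memory g) <= N * k)%N) (init k kmeans_prog eps x).
  by rewrite -[X in X <= _](model_cst1 k i0 x N); apply: H1 => B S s _ _ ->.
have one (E : config R -> bool) : (forall g, halted g && (nqueries (memory g) <= N * k)%N -> E g) ->
    prob (same_cluster a) (run_time n d k N) E (init k kmeans_prog eps x) = 1.
  move=> HE; apply/eqP; rewrite eq_le; have /andP[_ ->] := prob01 (same_cluster a) (run_time n d k N) E (init k kmeans_prog eps x).
  by apply: le_trans H1 _; apply: prob_mono.
split.
- have := run_time_le n0 d0 k0 (isT : (0 < N)%N).
  have : (10 ^ 3)%:R = 10 ^+ 3 :> R by rewrite natrX.
  move: (10 ^ 3)%N => t Ht Hr.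
  apply: (@le_trans _ _ (t * t * (n * d * (k * N)))%:R); first by rewrite ler_nat.
  have -> : 10 ^+ 19 * (n%:R * d%:R * k%:R ^+ 9 / eps ^+ 4) =
      (t * t * (n * d))%:R * (10 ^+ 13 * (k%:R ^+ 9 / eps ^+ 4)) :> R.
    rewrite !natrM Ht -exprD.
    have -> : 10 ^+ 19 = 10 ^+ (3 + 3) * 10 ^+ 13 :> R by rewrite -exprD.
    by move: (10 ^+ (3 + 3)) (10 ^+ 13) => u v; ring.
  by rewrite mulnA natrM ler_wpM2l // natrM.
- rewrite mulnC natrM; apply: le_trans NB _; rewrite ler_wpM2r //.
    by rewrite divr_ge0 ?exprn_ge0 // ltW.
  by rewrite ler_weXn2l // ler1n.
- by apply: one => g /andP[].
- by apply: one => g /andP[].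
- apply: le_trans (success_prob inj_x d0 k0 eps0 eps_le (erefl : val i0 = 0%N) optC vorC HN) _.
  apply: le_trans (prob_kmeans aC Ck (erefl : val i0 = 0%N) HN
    (P := fun s => Phi (output d k (Config [::] s)) (dataset x)
                      <= (1 + eps) * Delta k (dataset x)) _) _.
    move=> B S s sB sS _ Hs.
    exact: (success_sound i0 inj_x d0 k0 eps0 eps_le optC vorC HN sB sS Hs).
  by apply: prob_mono => g /andP[].
Qed.
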